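(* Let $G$ be any finite group and let $\chi\in\mathrm{Irr}(G)$. (i) If $G$ is solvable, then for every $g\in G$, $\omega_\chi(g)$ is divisible by $|Aut^0_G(g)|$. (ii) If $G$ is arbitrary but $\chi$ has height zero at a prime $p$ (that is, $\chi$ has height zero in its $p$-block), then for every $g\in G$, $\omega_\chi(g)$ is divisible by $|Aut^0_G(g)|_p$.
   Context: $\mathrm{Irr}(G)$ is the set of irreducible complex characters of $G$. For a positive integer $m$, $m_p$ is the $p$-part of $m$. If $\chi$ lies in a $p$-block with defect group $D$, then $\chi$ has height zero when $\chi(1)_p=|G|_p/|D|$. For $g\in G$, $h_g$ is the size of the conjugacy class of $g$ in $G$ and $\omega_\chi(g)=\frac{h_g\chi(g)}{\chi(1)}$ is the central character value (an algebraic integer). Divisibility of an algebraic integer $u$ by a positive integer $m$ means that $u/m$ is an algebraic integer. For an element $g\in G$ of order $n$ and a subgroup $H\subseteq G$, let $g^H$ be the set of $H$-conjugates of $g$ and let $Aut_H(g)=\{r\in\mathbb{Z}/n\mathbb{Z} : g^r\in g^H\}$, a subgroup of $(\mathbb{Z}/n\mathbb{Z})^*$. For each prime $q$ dividing $n$, let $n_{q'}$ be the largest divisor of $n$ prime to $q$, and set $Aut^0_{H,q}(g)=\{m\in Aut_H(g) : m\equiv 1 \bmod qn_{q'}\}$ if $q$ is odd or if $q=2$ and $4\nmid n$, and $Aut^0_{H,2}(g)=\{m\in Aut_H(g) : m\equiv 1\bmod 4n_{2'}\}$ if $q=2$ and $4\mid n$. Finally $Aut^0_H(g)=\prod_{q\mid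 n}Aut^0_{H,q}(g)$, a subgroup of $Aut_H(g)$. $Aut^0_G(g)$ is the case $H=G$. *)

(* Defs.v *)
From HB Require Import structures.
From mathcomp Require Import all_boot all_order all_algebra all_fingroup.
From mathcomp Require Import all_solvable all_field all_character.
Set Implicit Arguments.
Unset Strict Implicit.
Unset Printing Implicit Defensive.
Import Order.TTheory GRing.Theory Num.Theory GroupScope.
Local Open Scope ring_scope.

(* [Aut_H(g)] lives in the unit group of ['Z_n], n = #[g]: an exponent r with
   g ^+ r conjugate to g is automatically prime to n.  For n = 1, ['Z_1] is by
   convention Z/2Z, but its unit group is still trivial, as (Z/1Z)^* is. *)
Definition Autg (gT : finGroupType) (H : {set gT}) (g : gT) :
    {set {unit 'Z_#[g]}} :=
  [set r : {unit 'Z_#[g]} | (g ^+ (val r : 'Z_#[g]))%g \in g ^: H].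

Definition Autg0_modulus (n q : nat) : nat :=
  (if (q == 2) && (4 %| n) then 4 * n`_2^' else q * n`_q^')%N.

Definition Autg0_at (gT : finGroupType) (H : {set gT}) (g : gT) (q : nat) :
    {set {unit 'Z_#[g]}} :=
  [set r in Autg H g |
     ((val r : 'Z_#[g]) : nat) == 1 %[mod Autg0_modulus #[g] q]].

(* The product is the product of subsets of the group [{unit 'Z_n}]. *)
Definition Autg0 (gT : finGroupType) (H : {set gT}) (g : gT) :
    {set {unit 'Z_#[g]}} :=
  (\prod_(q <- primes #[g]) Autg0_at H g q)%g.

Definition omega (gT : finGroupType) (G : {group gT}) (chi : 'CF(G)) (g : gT) :
    algC :=
  #|g ^: G|%:R * chi g / chi 1%g.

(* p-blocks and defect groups are defined as in Isaacs and Navarro, by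
   reduction modulo a maximal ideal M, containing p, of the ring [Aint] of all
   algebraic integers. *)
Record Aint_ideal (I : algC -> Prop) : Prop := AintIdeal {
  Aint_ideal_sub : forall x, I x -> x \in Aint;
  Aint_ideal0 : I 0;
  Aint_idealD : forall x y, I x -> I y -> I (x + y);
  Aint_idealM : forall a x, a \in Aint -> I x -> I (a * x)
}.

Record Aint_maximal_over (p : nat) (M : algC -> Prop) : Prop :=
    AintMaximalOver {
  Aint_maximal_ideal : Aint_ideal M;
  Aint_maximal_proper : ~ M 1;
  Aint_maximalP : forall I, Aint_ideal I -> (forall x, M x -> I x) -> ~ I 1 ->
    forall x, I x -> M x;
  Aint_maximal_char : M p%:R
}.

(* Membership in the maximal ideal of the localization of [Aint] at M. *)
Definition loc_max (M : algC -> Prop) (x : algC) : Prop :=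
  exists a b : algC, [/\ M a, b \in Aint, ~ M b & x = a / b].

(* chi and psi determine the same central character modulo M. *)
Definition same_block (M : algC -> Prop) (gT : finGroupType) (G : {group gT})
    (i j : Iirr G) : Prop :=
  forall g, g \in G -> M (omega 'chi_i g - omega 'chi_j g).

Definition is_block (M : algC -> Prop) (gT : finGroupType) (G : {group gT})
    (B : {set Iirr G}) : Prop :=
  exists i : Iirr G, forall j : Iirr G, j \in B <-> same_block M i j.

(* Coefficient at g of the sum of the central idempotents
   e_chi = chi(1)/|G| \sum_g chi(g^-1) g over chi in B.  It lies in the
   localization of [Aint] at M, and its reduction is the coefficient at g of
   the block idempotent of B. *)
Definition block_idem_coef (gT : finGroupType) (G : {group gT})
    (B : {set Iirr G}) (g : gT) : algC :=
  #|G|%:R^-1 * \sum_(i in B) 'chi_i 1%g * 'chi_i g^-1%g.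

(* The defect groups of a block are the Sylow p-subgroups of the centralizers
   of the elements of its defect classes, i.e., the classes on which neither
   the central character of the block nor the coefficient of its idempotent
   vanishes modulo M. *)
Definition is_defect_group (p : nat) (M : algC -> Prop) (gT : finGroupType)
    (G : {group gT}) (B : {set Iirr G}) (D : {group gT}) : Prop :=
  exists g : gT,
    [/\ g \in G,
        forall i : Iirr G, i \in B -> ~ M (omega 'chi_i g),
        ~ loc_max M (block_idem_coef B g)
      & p.-Sylow('C_G[g]) D].

(* The blocks and their defect groups do not depend on the choice of M; the
   degree of an irreducible chi is read off as a natural number by
   [Num.truncn]. *)
Definition height_zero (p : nat) (gT : finGroupType) (G : {group gT})
    (chi : 'CF(G)) : Prop :=
  exists (M : algC -> Prop) (B : {set Iirr G}) (D : {group gT}),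
    [/\ Aint_maximal_over p M, is_block M B,
        exists2 i : Iirr G, i \in B & chi = 'chi_i,
        is_defect_group p M B D
      & ((Num.truncn (chi 1%g))`_p = #|G|`_p %/ #|D|)%N].

(* Main.v *)
Require Import Defs.
From mathcomp Require Import all_boot all_order all_algebra all_fingroup.
From mathcomp Require Import all_solvable all_field all_character.
From mathcomp Require Import zify ring.
From Stdlib Require Import Classical.
Set Implicit Arguments.
Unset Strict Implicit.
Unset Printing Implicit Defensive.
Import Order.TTheory GRing.Theory Num.Theory GroupScope.
Local Open Scope ring_scope.

(**
   Let g have order n, let p be a prime divisor of n, and let p ^ k be the order
   of Aut^0 at p.  As Aut^0 at p lies in a cyclic group of exponents congruent to
   1, it consists of all exponents congruent to 1 modulo n / p ^ k; so if Z is the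
   subgroup of order p ^ k of <[g]>, all the elements of the coset g Z are
   conjugate to g (Autg0_at_shift).  The orders of the factors of Aut^0 at
   different primes are coprime, so in both parts one has to show that #|Z|
   divides omega chi g, for a p-subgroup Z of <[g]> with g Z contained in the
   class of g.

   Solvable groups.  Put d = (#|G| / chi(1))_p.  The restriction of chi to a
   nilpotent subgroup E is a sum of characters induced from subgroups H with
   #|H|_p <= d (solvable_Res_small_induced).  To get an induction, this is proved
   for a character chi over an invariant character theta of a normal subgroup U,
   and for E / U nilpotent.  Let M / U be a minimal normal subgroup of G / U, which
   is a q-group: either chi is induced from the inertia group of a constituent f
   of its restriction to M, and Mackey's formula applies, or f is invariant and M
   can take the place of U, up to a comparison of degrees (deg_part_le_index).
   Now let s be the p'-part of g, let P be a Sylow p-subgroup of the normalizer of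
   g Z that contains the p-part of g, and let E = <[s]> P.  A character of any
   subgroup sums over g Z to a multiple of #|Z| (shift_coset_sum), so a character
   of E induced from H sums over g Z to a multiple of #|E : H| #|Z|; as chi is
   constant on g Z, chi(g) is divisible by #|P| / d.  Since the normalizer of g Z
   has order #|Z| #|C_G(g)|, this says that #|Z| divides omega chi g.

   Height zero.  The only consequence of height zero that matters is that there is
   an element l0 with omega chi l0 outside M whose class L has the same p-part as
   chi(1).  Let u and s be the p-part and the p'-part of g, and N the normalizer
   of <[u]>.  For q a power of p with s ^+ q = s,
     (omega chi l0) ^+ q * chi(g) = \sum chi(u (s l_1) (s l_2) .. (s l_q)),
   the sum being over all q-tuples of elements of L.  The rotation of tuples,
   twisted by u, does not change the summand, and a full turn of it is the
   conjugation by u^-1; hence modulo p q only the tuples that commute with u count,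
   and their sum can be evaluated in N (p_section_congruence).  For large q this
   expresses chi(g), locally at M, by the values psi(g) of the characters psi of N
   whose central character is not in M on the sum of the elements of L that
   commute with u.  For such a psi, #|N| / psi(1) divides the p-part of
   #|C_G(l0)| locally at M, and Z, which is normal in N, is in the kernel of psi
   unless psi(g) = 0, whence #|Z| divides omega psi g (normal_shift_dvd).  This
   gives the divisibility locally at M.  It holds for all the elements g ^+ k with k
   prime to n, at which chi takes the Galois conjugates of chi(g), and a number all
   of whose conjugates are integral at one ideal over p is integral at all of them
   (Lint_conjugates_Aint). *)

(** * One-units modulo prime powers *)

Section Lifting.
Local Open Scope nat_scope.

(** All the terms of the binomial expansion from the third on are divisible by
    p ^ (j + 2).  For p = 2 this needs j > 1 (indeed 3 ^ 2 = 1 + 2 ^ 3), hence the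
    hypothesis, which reads 0 < j for odd p and 1 < j for p = 2; it is the reason
    for the modulus 4 in the definition of Aut^0 at 2. *)
Lemma one_unit_exp_prime (p j t : nat) : prime p -> (p == 2) < j -> ~~ (p %| t) ->
  exists2 t', ~~ (p %| t') & (1 + p ^ j * t) ^ p = 1 + p ^ j.+1 * t'.
Proof.
move=> pr_p jP p't; have p_gt1 := prime_gt1 pr_p.
have j_gt0 : 0 < j by apply: leq_ltn_trans jP.
have Dd i : 1 < i <= p -> p ^ j.+2 %| 'C(p, i) * (p ^ j * t) ^ i.
  case/andP=> i_gt1 le_ip; rewrite expnMn mulnA -expnM dvdn_mulr //.
  case: (ltngtP i 2) => [|i_gt2|->]; first by rewrite ltnNge i_gt1.
    rewrite dvdn_mull // dvdn_exp2l //.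
    by rewrite (@leq_trans (j * 3)) ?leq_pmul2l // mulnC !mulSn mul0n; lia.
  have [p2|p'2] := eqVneq p 2.
    rewrite p2 eqxx /= in jP; rewrite dvdn_mull // dvdn_exp2l //; lia.
  have pdC : p %| 'C(p, 2).
    rewrite prime_dvd_bin //=; have := p_gt1; rewrite leq_eqVlt eq_sym.
    by rewrite (negPf p'2).
  rewrite -(prednK (n := j.+2)) // expnS dvdn_mul // dvdn_exp2l //; lia.
have /dvdnP[m Dm] : p ^ j.+2 %| \sum_(2 <= i < p.+1) 'C(p, i) * (p ^ j * t) ^ i.
  rewrite big_seq; apply: dvdn_sum => i; rewrite mem_index_iota ltnS; exact: Dd.
exists (t + p * m); first by rewrite dvdn_addl // dvdn_mulr.
rewrite expnDn -(big_mkord xpredT (fun i => 'C(p, i) * (1 ^ (p - i) * (p ^ j * t) ^ i))).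
rewrite big_ltn // big_ltn ?ltnS; last by lia.
have {}Dm : \sum_(2 <= i < p.+1) 'C(p, i) * (1 ^ (p - i) * (p ^ j * t) ^ i) = m * p ^ j.+2.
  by rewrite -Dm; apply: eq_bigr => i _; rewrite exp1n mul1n.
rewrite bin0 bin1 expn0 expn1 !exp1n !mul1n Dm mulnDr addnA mulnA expnS.
by rewrite !expnS; ring.
Qed.

Lemma one_unit_exp_prime_power (p j t i : nat) :
    prime p -> (p == 2) < j -> ~~ (p %| t) ->
  exists2 t', ~~ (p %| t') & (1 + p ^ j * t) ^ (p ^ i) = 1 + p ^ (j + i) * t'.
Proof.
move=> pr_p jP p't; elim: i => [|i [t1 p't1 IHi]].
  by exists t; rewrite ?addn0 ?expn1.
have [|t2 p't2 Dt2] := one_unit_exp_prime (j := j + i) pr_p _ p't1.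
  exact: ltn_addr.
by exists t2; rewrite // expnSr expnM IHi Dt2 addnS.
Qed.

End Lifting.

(** * Aut^0 at a prime as a group of translations *)

Section Autg0.

Variables (gT : finGroupType) (G : {group gT}) (g : gT).
Implicit Types (p q : nat) (r : {unit 'Z_#[g]}).

Local Notation expo r := (nat_of_ord (val r : 'Z_#[g])).

Lemma Autg0_atP q r :
  reflect ((g ^+ (expo r))%g \in g ^: G /\ expo r = 1 %[mod Autg0_modulus #[g] q])
          (r \in Autg0_at G g q).
Proof. by rewrite !inE; apply: (iffP andP) => [[? /eqP]|[? ?]]; split=> //; apply/eqP. Qed.

Lemma Autg0_modulus_dvd q : q \in primes #[g] -> (Autg0_modulus #[g] q %| #[g])%N.
Proof.
rewrite mem_primes => /and3P[pr_q n_gt0 q_n].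
rewrite /Autg0_modulus -[X in (_ %| X)%N](partnC q n_gt0).
case: ifP => [/andP[/eqP-> d4]|_]; rewrite dvdn_pmul2r ?part_gt0 // p_part.
  by rewrite (@dvdn_exp2l 2 2) // -pfactor_dvdn.
by rewrite (@dvdn_exp2l q 1) // logn_gt0 mem_primes pr_q n_gt0.
Qed.

Lemma expo_expg q r k : q \in primes #[g] ->
  expo (r ^+ k)%g = expo r ^ k %[mod #[g]].
Proof.
rewrite mem_primes => /and3P[pr_q n_gt0 q_n].
have n_gt1 : (1 < #[g])%N by apply: leq_trans (prime_gt1 pr_q) (dvdn_leq n_gt0 q_n).
rewrite FinRing.val_unitX -[val r]natr_Zp -natrX.
by rewrite !val_Zp_nat // modn_mod modnXm.
Qed.

Lemma Autg0_at_group q : q \in primes #[g] -> group_set (Autg0_at G g q).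
Proof.
move=> q_n; have d_n := Autg0_modulus_dvd q_n.
have n_gt1 : (1 < #[g])%N.
  move: q_n; rewrite mem_primes => /and3P[pr_q n_gt0 q_n].
  by apply: leq_trans (prime_gt1 pr_q) (dvdn_leq n_gt0 q_n).
apply/group_setP; split=> [|r1 r2 /Autg0_atP[/imsetP[x Gx Dx] E1] /Autg0_atP[Cr2 E2]].
  apply/Autg0_atP; rewrite FinRing.val_unit1 /=.
  by rewrite /= modn_small // expg1 class_refl.
have Em : expo (r1 * r2)%g = expo r1 * expo r2 %[mod #[g]].
  rewrite FinRing.val_unitM -[val r1]natr_Zp -[val r2]natr_Zp -natrM.
  by rewrite !val_Zp_nat // modn_mod modnMml modnMmr.
apply/Autg0_atP; split.
  rewrite -expg_mod_order Em expg_mod_order expgM Dx -conjXg.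
  by case/imsetP: Cr2 => y Gy ->; rewrite -conjgM imset_f ?groupM.
rewrite -(modn_dvdm _ d_n) Em (modn_dvdm _ d_n).
by rewrite -modnMm E1 E2 modnMm.
Qed.

Lemma expo_gt0 q r : q \in primes #[g] -> r \in Autg0_at G g q -> (0 < expo r)%N.
Proof.
move=> q_n /Autg0_atP[_ E]; rewrite lt0n; apply: contra_eq_neq E => ->.
have pr_q : prime q by move: q_n; rewrite mem_primes => /and3P[].
have : (1 < Autg0_modulus #[g] q)%N.
  rewrite /Autg0_modulus; case: ifP => _; apply: leq_trans (leq_pmulr _ (part_gt0 _ _)) => //.
  exact: prime_gt1.
by move=> d1; rewrite mod0n modn_small.
Qed.

(** If r0 in Aut^0 at p minimizes the exponent j of p in r0 - 1, then the
    powers of r0 are all the exponents congruent to 1 modulo m = p ^ j * n_p',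
    where n is the order of g.  So Aut^0 at p consists of these exponents, and the
    elements g ^+ r with r in Aut^0 at p form the coset of the subgroup Z generated
    by g ^+ m. *)
Lemma Autg0_at_shift p : p \in primes #[g] ->
  exists Z : {group gT}, [/\ Z \subset <[g]>, p.-group Z, #|Z| = #|Autg0_at G g p|
    & forall z, z \in Z -> (g * z)%g \in g ^: G].
Proof.
move=> p_n; pose A := Group (Autg0_at_group p_n).
have [pr_p n_gt0 p_dv_n] : [/\ prime p, 0 < #[g] & p %| #[g]]%N.
  by move: (p_n); rewrite mem_primes => /and3P[].
have n_gt1 : (1 < #[g])%N by apply: leq_trans (prime_gt1 pr_p) (dvdn_leq n_gt0 p_dv_n).
have expo_lt r : (expo r < #[g])%N by rewrite -[X in (_ < X)%N]Zp_cast ?ltn_ord.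
have expo_inj r1 r2 : expo r1 = expo r2 -> r1 = r2 by move=> E; do 2!apply: val_inj.
have expo1 : expo (1%g : {unit 'Z_#[g]}) = 1%N by rewrite FinRing.val_unit1 /= modn_small.
set n := #[g] in n_gt0 p_dv_n n_gt1 expo_lt *; pose a := logn p n.
have Dn : n = (p ^ a * n`_p^')%N by rewrite -p_part partnC.
have coA b : coprime (p ^ b) n`_p^'.
  by rewrite coprimeXl // prime_coprime // -p'natE ?part_pnat.
have [A1 | ntA] := eqVneq (A : {set _}) 1%g.
  exists 1%G; rewrite sub1G pgroup1 -[Autg0_at _ _ _]/(gval A) A1 !cards1; split=> // z /set1P->.
  by rewrite mulg1 class_refl.
have /trivgPn[r1 Ar1 ntr1] := ntA.
have ex1 : [&& r1 \in A & r1 != 1%g] by rewrite Ar1.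
case: (@arg_minnP _ r1 [pred r | [&& r \in A & r != 1%g]] (fun r => logn p (expo r).-1) ex1).
move=> r0 /andP[Ar0 ntr0] min_r0 {r1 Ar1 ntr1 ex1}; set j := logn p _ in min_r0.
have [d_n Ad] : (Autg0_modulus n p %| n /\
    forall r, r \in A -> Autg0_modulus n p %| (expo r).-1)%N.
  split=> [|r Ar]; first exact: Autg0_modulus_dvd.
  have r_gt0 := expo_gt0 p_n Ar; case/Autg0_atP: Ar => _ /eqP.
  by rewrite eqn_mod_dvd // subn1.
have [dp' dp] : (n`_p^' %| Autg0_modulus n p /\ p %| Autg0_modulus n p)%N.
  rewrite /Autg0_modulus; case: ifP => [/andP[/eqP-> _]|_]; first by rewrite dvdn_mull ?dvdn_mulr.
  by rewrite dvdn_mull ?dvdn_mulr.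
have logpos r : r \in A -> r != 1%g -> (0 < (expo r).-1)%N.
  move=> Ar ntr; have r_gt0 := expo_gt0 p_n Ar.
  rewrite -ltnS prednK // ltn_neqAle r_gt0 andbT eq_sym.
  by apply: contraNneq ntr => E; apply/eqP/expo_inj; rewrite expo1.
have lt_ja : (j < a)%N.
  rewrite ltnNge; apply: contraL (expo_lt r0) => le_aj; rewrite -leqNgt.
  have: (n %| (expo r0).-1)%N.
    rewrite Dn Gauss_dvd //; rewrite (dvdn_trans dp' (Ad _ Ar0)) andbT.
    by rewrite pfactor_dvdn ?logpos.
  by move/(dvdn_leq (logpos _ Ar0 ntr0))/leq_trans; apply; exact: leq_pred.
have j_gt0 : (0 < j)%N.
  by rewrite logn_gt0 mem_primes pr_p logpos ?(dvdn_trans dp (Ad _ Ar0)).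
have jP : ((p == 2) < j)%N.
  case: eqP => [p2|//]; move: (Ad _ Ar0); rewrite /Autg0_modulus p2 eqxx.
  have n4 : (4 %| n)%N.
    by have := leq_ltn_trans j_gt0 lt_ja; rewrite /a p2 (@pfactor_dvdn 2 2).
  rewrite n4 /= => /(dvdn_trans (dvdn_mulr _ (dvdnn _))).
  by rewrite (@pfactor_dvdn 2 2) ?logpos // /j p2.
pose m := (p ^ j * n`_p^')%N.
have m_n : (m * p ^ (a - j) = n)%N.
  by rewrite /m mulnAC -expnD subnKC -?Dn // ltnW.
have Am r : r \in A -> (m %| (expo r).-1)%N.
  move=> Ar; have [->|ntr] := eqVneq r 1%g; first by rewrite expo1.
  rewrite /m Gauss_dvd // (dvdn_trans dp' (Ad _ Ar)) andbT.
  by rewrite pfactor_dvdn ?logpos // min_r0 //= Ar.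
pose Z := <[(g ^+ m)%g]>%G.
have cardZ : #|Z| = (p ^ (a - j))%N.
  have m_gt0 : (0 < m)%N by rewrite /m muln_gt0 part_gt0 expn_gt0 prime_gt0.
  rewrite -orderE orderXdiv -/n; last by rewrite -m_n dvdn_mulr.
  by rewrite -[X in (X %/ _)%N]m_n mulKn.
have [t p't Dt] : exists2 t, ~~ (p %| t)%N & expo r0 = (1 + p ^ j * t)%N.
  have [t co_t Dt] := pfactor_coprime pr_p (logpos _ Ar0 ntr0).
  exists t; last by rewrite mulnC -Dt add1n prednK // (expo_gt0 p_n Ar0).
  by rewrite -prime_coprime.
have ordr0 : #[r0]%g = (p ^ (a - j))%N.
  have Xr0 i : ((r0 ^+ (p ^ i))%g == 1%g) = (a <= j + i)%N.
    have [t' p't' Dt'] := one_unit_exp_prime_power i pr_p jP p't.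
    have E : expo (r0 ^+ (p ^ i))%g = (1 + p ^ (j + i) * t')%N %[mod n].
      by rewrite (expo_expg _ _ p_n) Dt Dt'.
    have ArX : (r0 ^+ (p ^ i))%g \in A by rewrite groupX.
    have n'dv : (n`_p^' %| p ^ (j + i) * t')%N.
      have: (n`_p^' %| (expo (r0 ^+ (p ^ i))%g).-1)%N.
        by rewrite (dvdn_trans dp') // Ad.
      rewrite -subn1 -eqn_mod_dvd; last exact: (expo_gt0 p_n).
      rewrite -(modn_dvdm _ (dvdn_part _ n)) E (modn_dvdm _ (dvdn_part _ n)).
      by rewrite eqn_mod_dvd ?leq_addr // addKn.
    apply/eqP/idP => [r1 | le_a].
      move: E; rewrite r1 expo1 => /esym/eqP; rewrite eqn_mod_dvd ?leq_addr // addKn.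
      move=> H; have {H}: (p ^ a %| p ^ (j + i) * t')%N.
        by apply: dvdn_trans H; rewrite Dn dvdn_mulr.
      by rewrite Gauss_dvdl ?coprimeXl ?prime_coprime // dvdn_Pexp2l ?prime_gt1.
    apply: expo_inj; rewrite expo1 -[LHS](modn_small (expo_lt _)) E.
    have /dvdnP[k ->] : (n %| p ^ (j + i) * t')%N.
      by rewrite {1}Dn Gauss_dvd // n'dv andbT dvdn_mulr // dvdn_exp2l.
    by rewrite addnC modnMDl modn_small.
  have: (#[r0]%g %| p ^ (a - j))%N by rewrite order_dvdn Xr0 subnKC // ltnW.
  case/(dvdn_pfactor _ _ pr_p) => i le_i Di; rewrite Di; congr (p ^ _)%N; apply/eqP.
  rewrite eqn_leq le_i leq_subLR -Xr0 -Di expg_order eqxx //.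
pose f r := (g ^+ (expo r).-1)%g.
have f_inj : {in A &, injective f}.
  move=> r s Ar As /eqP; rewrite eq_expg_mod_order.
  have lt_pred (k : {unit 'Z_#[g]}) : ((expo k).-1 < n)%N.
    exact: leq_ltn_trans (leq_pred (expo k)) (expo_lt k).
  rewrite !modn_small ?lt_pred // => /eqP E; apply: expo_inj.
  by rewrite -[LHS]prednK ?E ?prednK // (expo_gt0 p_n).
have sfZ : f @: A \subset Z.
  apply/subsetP=> _ /imsetP[r Ar ->]; have /dvdnP[k Dk] := Am r Ar.
  by rewrite /f Dk mulnC expgM mem_cycle.
have EfZ : f @: A = Z.
  apply/eqP; rewrite eqEcard sfZ card_in_imset //= cardZ -ordr0.
  by rewrite orderE subset_leq_card ?(cycle_subG r0 A).
exists Z; split.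
- by rewrite cycle_subG mem_cycle.
- by rewrite /pgroup cardZ pnatX pnat_id.
- by rewrite -EfZ card_in_imset.
move=> z; rewrite -EfZ => /imsetP[r Ar ->].
rewrite /f -expgS prednK ?(expo_gt0 p_n Ar) //.
by case/Autg0_atP: Ar.
Qed.

Lemma Autg0_at_pnat q : q \in primes #[g] -> q.-nat #|Autg0_at G g q|.
Proof. by case/Autg0_at_shift=> Z [_ qZ <- _]. Qed.

(** The factors have pairwise coprime orders, as Aut^0 at q is a q-group, and
    they commute, so the product of subsets is a direct product of groups. *)
Lemma card_Autg0 : #|Autg0 G g| = (\prod_(q <- primes #[g]) #|Autg0_at G g q|)%N.
Proof.
rewrite /Autg0; move: (primes_uniq #[g]).
suffices: forall s, uniq s -> {subset s <= primes #[g]} ->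
    exists2 K : {group {unit 'Z_#[g]}}, (\prod_(q <- s) Autg0_at G g q)%g = K
      & #|K| = (\prod_(q <- s) #|Autg0_at G g q|)%N
        /\ (forall q, q \in primes #[g] -> q \notin s -> coprime #|Autg0_at G g q| #|K|).
  by move=> H /H[//|K -> []].
elim=> [|q s IHs] /=; first by exists 1%G; rewrite ?big_nil // cards1; split=> // q; rewrite coprimen1.
case/andP=> s'q uniq_s /allP/=/andP[nq /allP sn]; have [K DK [cK coK]] := IHs uniq_s sn.
pose A := Group (Autg0_at_group nq).
have cAK : (A * K)%g = (A <*> K)%g.
  by rewrite comm_joingE //; apply: normC; apply/cents_norm/centsP=> x _ y _; apply: unit_Zp_mulgC.
have cardAK : #|(A <*> K)%g| = (#|Autg0_at G g q| * #|K|)%N.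
  by rewrite -cAK coprime_cardMg //= coK.
exists (A <*> K)%G; first by rewrite big_cons DK cAK.
rewrite cardAK cK big_cons; split=> // r nr.
rewrite inE negb_or => /andP[q'r s'r]; rewrite -cK coprimeMr coK // andbT.
have [pr_r pr_q] : prime r /\ prime q by move: (nr) (nq); rewrite !mem_primes => /andP[? _] /andP[? _].
apply: (@pnat_coprime r); first exact: Autg0_at_pnat.
by apply: sub_in_pnat (Autg0_at_pnat nq) => l _; rewrite !inE => /eqP->; rewrite eq_sym.
Qed.

Lemma part_Autg0 p : p \in primes #[g] -> (#|Autg0 G g|`_p = #|Autg0_at G g p|)%N.
Proof.
move=> p_n; rewrite card_Autg0 (bigD1_seq p) ?primes_uniq //=.
have pA := Autg0_at_pnat p_n; rewrite partnM //.
  rewrite part_pnat_id // part_p'nat ?muln1 //.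
  rewrite big_seq_cond; elim/big_rec: _ => [|q m /andP[q_n p'q] p'm]; first by [].
  rewrite pnatM p'm andbT; apply: sub_in_pnat (Autg0_at_pnat q_n) => l _.
  by rewrite !inE => /eqP->.
  by have /andP[] := pA.
rewrite big_seq_cond; apply: prodn_cond_gt0 => q /andP[q_n _].
by have /andP[] := Autg0_at_pnat q_n.
Qed.

Lemma part_Autg0_out p : p \notin primes #[g] -> (#|Autg0 G g|`_p = 1)%N.
Proof.
move=> p'n; apply: part_p'nat; rewrite card_Autg0 big_seq.
elim/big_rec: _ => [|q m q_n p'm]; first by [].
rewrite pnatM p'm andbT; apply: sub_in_pnat (Autg0_at_pnat q_n) => l _.
by rewrite !inE => /eqP->; apply: contraNneq p'n => <-.
Qed.

Lemma card_Autg0_gt0 : (0 < #|Autg0 G g|)%N.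
Proof.
rewrite card_Autg0 big_seq; apply: prodn_cond_gt0 => q q_n.
by have /andP[] := Autg0_at_pnat q_n.
Qed.

End Autg0.

Lemma Aint_coprime_mul (a b : nat) (y : algC) : coprime a b ->
  a%:R * y \in Aint -> b%:R * y \in Aint -> y \in Aint.
Proof.
case: (posnP a) => [->|a_gt0]; first by rewrite /coprime gcd0n => /eqP-> _; rewrite mul1r.
move=> /eqP co_ab Aay Aby; have [c _] := Bezoutl b a_gt0.
rewrite co_ab => /dvdnP[k Dk].
have -> : y = k%:R * (a%:R * y) - c%:R * (b%:R * y).
  by rewrite !mulrA -mulrBl -!natrM -Dk natrD addrK mul1r.
by apply: rpredB; apply: rpredM => //; apply: rpred_nat.
Qed.

Lemma dvd_card_Autg0 (gT : finGroupType) (G : {group gT}) (g : gT) (x : algC) :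
    (forall p, p \in primes #[g] -> x / #|Autg0_at G g p|%:R \in Aint) ->
  x \in Aint -> x / #|Autg0 G g|%:R \in Aint.
Proof.
move=> Ax Aint_x; have n0 p : p \in primes #[g] -> (0 < #|Autg0_at G g p|)%N.
  by move=> p_n; have /andP[] := Autg0_at_pnat G p_n.
rewrite card_Autg0; move: (primes_uniq #[g]).
have: {subset primes #[g] <= primes #[g]} by [].
elim: {1 3 4}(primes #[g]) => [|q s IHs] /=; first by rewrite big_nil divr1.
move=> /allP/=/andP[nq /allP sn] /andP[s'q uniq_s]; have {}IHs := IHs sn uniq_s.
set b := (\prod_(i <- s) _)%N in IHs; rewrite big_cons -/b.
have q'b : q^'.-nat b.
  rewrite /b big_seq; elim/big_rec: _ => [|r m s_r q'm]; first by [].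
  rewrite pnatM q'm andbT; apply: sub_in_pnat (Autg0_at_pnat G (sn r s_r)) => l _.
  by rewrite !inE => /eqP->; apply: contraNneq s'q => <-.
have nz_b : b%:R != 0 :> algC by rewrite pnatr_eq0 -lt0n; case/andP: q'b.
have nz_q : #|Autg0_at G g q|%:R != 0 :> algC by rewrite pnatr_eq0 -lt0n n0.
apply: (@Aint_coprime_mul #|Autg0_at G g q| b).
- by apply: pnat_coprime q'b; exact: Autg0_at_pnat.
- suffices -> : #|Autg0_at G g q|%:R * (x / (#|Autg0_at G g q| * b)%:R) = x / b%:R by [].
  by rewrite natrM; field; rewrite ?nz_b ?nz_q.
suffices -> : b%:R * (x / (#|Autg0_at G g q| * b)%:R) = x / #|Autg0_at G g q|%:R by exact: Ax.
by rewrite natrM; field; rewrite ?nz_b ?nz_q.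
Qed.

(** * Characters over a fixed character of a normal subgroup *)

Local Notation deg i := (irr_degree (socle_of_Iirr i)).

Section Relative.
Variable gT : finGroupType.
Implicit Types (G H K M E T U : {group gT}).

(** For an irreducible chi and U normal, this says that the restriction of chi to U
    is a multiple of 'chi_t, and hence that 'chi_t is invariant. *)
Definition homogeneous U (t : Iirr U) G (chi : 'CF(G)) : Prop :=
  {subset irr_constt ('Res[U] chi) <= pred1 t}.

Lemma Ind_irr_constt G H (i : Iirr G) (j : Iirr H) :
  'chi_i = 'Ind[G] 'chi_j -> j \in irr_constt ('Res[H] 'chi_i).
Proof. by move=> Di; rewrite -constt_Ind_Res -Di constt_irr inE. Qed.

Lemma homogeneous_sub U (t : Iirr U) G H (i : Iirr G) (j : Iirr H) :
    U \subset H -> H \subset G -> homogeneous t 'chi_i -> j \in irr_constt ('Res[H] 'chi_i) ->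
  homogeneous t 'chi_j.
Proof.
move=> sUH sHG ti ij k kj; apply: ti; rewrite -(cfResRes _ sUH sHG).
by apply: constt_Res_trans kj; rewrite ?cfRes_char ?irr_char.
Qed.

Lemma homogeneous_constt U (t : Iirr U) G (i : Iirr G) :
  homogeneous t 'chi_i -> t \in irr_constt ('Res[U] 'chi_i).
Proof. by have [j ij] := constt_cfRes_irr U i => ti; have /eqP <- := ti j ij. Qed.

Lemma homogeneous_irr U (t : Iirr U) G (i : Iirr G) :
  homogeneous t 'chi_i -> 'Res[U] 'chi_i \in irr U -> 'Res[U] 'chi_i = 'chi_t.
Proof.
by move=> ti /irrP[j Dj]; have := ti j; rewrite Dj constt_irr !inE eqxx => /(_ isT)/eqP->.
Qed.

(** The Clifford correspondence, with T the inertia group of 'chi_t. *)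
Lemma Clifford_cases U G (i : Iirr G) (t : Iirr U) :
    U <| G -> t \in irr_constt ('Res[U] 'chi_i) ->
  homogeneous t 'chi_i \/
  exists T : {group gT}, [/\ U \subset T, T \proper G
    & exists j : Iirr T, 'chi_i = 'Ind[G] 'chi_j].
Proof.
move=> nsUG it; pose T := 'I_G['chi_t]%G.
have [sGT | prT] := boolP (G \subset T).
  left=> k; rewrite (Clifford_Res_sum_cfclass nsUG it) cfclass_invariant.
    rewrite big_seq1 !inE /= cfdotZl cfdot_irr eq_sym.
    by case: (eqVneq k t) => // _; rewrite mulr0 eqxx.
  by apply: subset_trans sGT _; rewrite subsetIr.
right; exists T; split; first exact: sub_Inertia (normal_sub nsUG).
  by rewrite properE Inertia_sub.
have [irrI _ im _ _] := constt_Inertia_bijection t nsUG.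
have: i \in irr_constt ('Ind[G] 'chi_t) by rewrite constt_Ind_Res.
rewrite -im => /imsetP[j Aj ->]; exists j.
by rewrite cfIirrE // irrI.
Qed.

Lemma constt_Res_split G H (psi : 'CF(G)) (j : Iirr H) :
    psi \is a character -> j \in irr_constt ('Res[H] psi) ->
  exists2 i, i \in irr_constt psi & j \in irr_constt ('Res[H] 'chi_i).
Proof.
move=> Npsi; rewrite {1}[psi]cfun_sum_constt linear_sum /= inE /= cfdot_suml => nz.
have /existsP[i /andP[psi_i ij]] :
    [exists i, (i \in irr_constt psi) && (j \in irr_constt ('Res[H] 'chi_i))].
  apply: contraR nz; rewrite negb_exists => /forallP H0.
  rewrite big1 // => i psi_i; move: (H0 i); rewrite psi_i /= linearZ /= cfdotZl.
  by rewrite negbK => /eqP->; rewrite mulr0.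
by exists i.
Qed.

Lemma index_lt_proper U T G : U \subset T -> T \proper G -> (#|T : U| < #|G : U|)%N.
Proof.
move=> sUT ltTG; have sTG := proper_sub ltTG.
rewrite -(Lagrange_index sTG sUT) ltn_Pmull ?indexg_gt0 //.
by rewrite indexg_gt1; case/properP: ltTG => _ [x Gx T'x]; apply/subsetPn; exists x.
Qed.

(** The relative form of the fact that nilpotent groups are monomial.  Let K / U
    be central of prime order in E / U.  If the restriction of 'chi_k to U or K is
    not homogeneous, Clifford theory gives a proper subgroup.  Otherwise its
    constituent f on K restricts irreducibly to U, since it would else restrict to a
    sum of distinct characters, and the induction applies with K in place of U. *)
Lemma nilpotent_rel_monomial E U (k : Iirr E) : U <| E -> nilpotent (E / U) ->
  exists H, exists h : Iirr H,
    [/\ U \subset H, H \subset E, 'chi_k = 'Ind[E] 'chi_h & 'Res[U] 'chi_h \in irr U].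
Proof.
have [n] := ubnP #|E : U|; elim: n => // n IHn in E U k * => /ltnSE le_n nsUE nilE.
have sUE := normal_sub nsUE.
have properT T (j : Iirr T) : U \subset T -> T \proper E -> 'chi_k = 'Ind[E] 'chi_j ->
  exists H, exists h : Iirr H,
    [/\ U \subset H, H \subset E, 'chi_k = 'Ind[E] 'chi_h & 'Res[U] 'chi_h \in irr U].
- move=> sUT ltTE Dk; have sTE := proper_sub ltTE.
  have [||H [h [sUH sHT Dj irrh]]] := IHn T U j (leq_trans (index_lt_proper sUT ltTE) le_n).
  - exact: normalS sUT sTE nsUE.
  - exact: nilpotentS (quotientS _ sTE) nilE.
  exists H, h; split; rewrite ?(subset_trans sHT) //.
  by rewrite Dk Dj cfIndInd.
have [t kt] := constt_cfRes_irr U k.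
case: (Clifford_cases nsUE kt) => [tk | [T [sUT ltTE [j Dk]]]]; last exact: properT Dk.
have [trE | ntE] := eqVneq (E / U)%g 1%g.
  have DE : E = U.
    by apply/val_inj/eqP; rewrite /= eqEsubset sUE andbT -quotient_sub1 ?normal_norm // trE.
  case: _ / DE in nsUE nilE sUE properT t kt tk trE le_n *.
  by exists E, k; split=> //; rewrite ?cfInd_id ?cfRes_id ?mem_irr.
have ntZ : 'Z(E / U)%g != 1%g by rewrite center_nil_eq1.
have [p pr_p p_dv] : exists2 p, prime p & (p %| #|'Z(E / U)%g|)%N.
  by exists (pdiv #|'Z(E / U)%g|); rewrite ?pdiv_dvd ?pdiv_prime ?cardG_gt1.
have [x Zx ox] := Cauchy pr_p p_dv.
have nsxE : <[x]> <| E / U by apply: sub_center_normal; rewrite cycle_subG.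
have [K Dx sUK nsKE] := inv_quotientN nsUE nsxE; have sKE := normal_sub nsKE.
have nsUK : U <| K := normalS sUK sKE nsUE.
have iKU : #|K : U| = p by rewrite -card_quotient ?normal_norm // -Dx -orderE.
have [f kf] := constt_cfRes_irr K k.
case: (Clifford_cases nsKE kf) => [fk | [T [sKT ltTE [j Dk]]]]; last first.
  exact: properT (subset_trans sUK sKT) ltTE Dk.
have tf : homogeneous t 'chi_f := homogeneous_sub sUK sKE tk kf.
have irr_f : 'Res[U] 'chi_f \in irr U.
  case: (cfRes_prime_irr_cases f nsUK iKU pr_p) => // [[c inj_c Dc]].
  have c_t i : c i = t.
    apply/eqP/tf; rewrite Dc inE /= cfdot_suml (bigD1 i) //= cfdot_irr eqxx big1 ?addr0 ?oner_eq0 //.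
    by move=> l ne; rewrite cfdot_irr (inj_eq inj_c) (negPf ne).
  have p_gt0 := prime_gt0 pr_p; have p_gt1 := prime_gt1 pr_p.
  by have /inj_c[] : c (Ordinal p_gt0) = c (Ordinal p_gt1) by rewrite !c_t.
have [||H [h [sKH sHE Dk irrh]]] := IHn E K k _ nsKE.
- apply: leq_trans le_n; rewrite -(Lagrange_index sKE sUK) iKU.
  by rewrite ltn_Pmulr ?prime_gt1 ?indexg_gt0.
- have := third_isog sUK nsUE nsKE => /isog_nil <-; exact: quotient_nil.
exists H, h; split; rewrite ?(subset_trans sUK) //.
rewrite -(cfResRes _ sUK sKH) (homogeneous_irr (t := f)) //.
exact: homogeneous_sub sKH sHE fk (Ind_irr_constt Dk).
Qed.

(** * Mackey's formula *)

Lemma cfIsom_conjE T (x y : gT) (psi : 'CF(T)) :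
  cfIsom (conj_isom T x) psi y = psi (y ^ x^-1)%g.
Proof.
have [Ty | T'y] := boolP (y \in (T :^ x)%g); last by rewrite !cfun0 // -mem_conjg.
by rewrite -{1}[y](conjgKV x) cfIsomE -?mem_conjg.
Qed.

Lemma cfInd_conj T G x (psi : 'CF(T)) : T \subset G -> x \in G ->
  'Ind[G] (cfIsom (conj_isom T x) psi) = 'Ind[G] psi.
Proof.
move=> sTG Gx; have sTxG : T :^ x \subset G by rewrite -(conjGid Gx) conjSg.
apply/cfun_inP=> y Gy; rewrite !cfIndE // cardJg; congr (_ * _).
rewrite (reindex_inj (mulIg x)); apply: eq_big => [z | z _]; first by rewrite groupMr.
by rewrite cfIsom_conjE conjgM conjgK.
Qed.

(** The contribution of one double coset to Mackey's formula.  With z = e * x * t,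
    the value of psi at y ^ z does not depend on t, and each z arises from #|S|
    pairs (e, t). *)
Lemma Mackey_block E H (x : gT) (S : {group gT}) (psi : 'CF(H)) (rho : 'CF(S)) (y : gT) :
    S :=: (E :&: H :^ x^-1)%g -> {in S, forall s, rho s = psi (s ^ x)%g} -> y \in E ->
  #|H|%:R^-1 * (\sum_(z in ((E :* x) * H)%g) psi (y ^ z)%g) = 'Ind[E] rho y.
Proof.
move=> DS Drho Ey; have sSE : S \subset E by rewrite DS subsetIl.
rewrite cfIndE //; apply: (canLR (mulKf (neq0CG H))); rewrite mulrCA.
apply: (canRL (mulKf (neq0CG S))).
have Drho' e : e \in E -> rho (y ^ e)%g = psi (y ^ (e * x))%g.
  move=> Ee; have [Se|S'e] := boolP ((y ^ e)%g \in S); first by rewrite Drho // conjgM.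
  rewrite cfun0 // cfun0 //; apply: contra S'e => Hex.
  by rewrite DS inE groupJ //= mem_conjgV -conjgM.
transitivity (\sum_(u in setX E H) psi (y ^ (u.1 * x * u.2))%g).
  rewrite (partition_big (fun u : gT * gT => u.1 * x * u.2)%g (mem ((E :* x) * H)%g)) /=; last first.
    by move=> [e t] /setXP[Ee Ht] /=; rewrite !mem_mulg ?set11.
  rewrite mulr_sumr; apply: eq_bigr => _ /mulsgP[_ t1 /rcosetP[e1 Ee1 ->] Ht1 ->].
  rewrite (eq_bigr (fun _ => psi (y ^ (e1 * x * t1))%g)) => [|u /andP[_ /eqP->] //].
  rewrite sumr_const -[in RHS]mulr_natl; congr (_%:R * _).
  pose h (s : gT) := (e1 * s^-1, s ^ x * t1)%g.
  have h_inj : injective h by move=> s1 s2 [/mulgI/invg_inj].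
  rewrite -(card_imset _ h_inj); apply: eq_card => -[e t]; apply/imsetP/idP.
    case=> s Ss [-> ->]; move: Ss; rewrite DS inE mem_conjgV => /andP[Es Hs].
    have Hst : (s ^ x * t1)%g \in H by rewrite groupM.
    rewrite unfold_in /= in_setX /= Hst groupM ?groupV //=.
    by apply/eqP; rewrite /conjg !mulgA mulgK mulgVK.
  move=> et; have /andP[Xet /eqP D] : ((e, t) \in setX E H) && (e * x * t == e1 * x * t1)%g := et.
  move: Xet; rewrite in_setX => /andP[/= Ee Ht].
  exists (e^-1 * e1)%g; last first.
    rewrite /h invMg invgK mulKVg; congr (_, _).
    by apply: (mulgI (e * x)%g); rewrite D /conjg !mulgA mulgK mulgV mul1g.
  rewrite DS inE groupM ?groupV //= mem_conjgV.
  have -> : ((e^-1 * e1) ^ x = t * t1^-1)%g.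
    by rewrite /conjg -mulgA; apply: (canRL (mulgK _)); rewrite -!mulgA (mulgA e1) -D !mulgA mulgVK mulVg mul1g.
  by rewrite groupM ?groupV.
rewrite (eq_bigl (fun u => (u.1 \in E) && (u.2 \in H))) => [|u]; last by rewrite inE.
rewrite -(pair_big (mem E) (mem H) (fun e t => psi (y ^ (e * x * t))%g)) /= mulr_sumr.
apply: eq_bigr => e Ee; rewrite Drho' //.
rewrite (eq_bigr (fun _ => psi (y ^ (e * x))%g)) => [|t Ht]; first by rewrite sumr_const mulr_natl.
by rewrite conjgM cfunJ.
Qed.

Lemma Res_Ind_mulg E H G (psi : 'CF(H)) : H \subset G -> E \subset G -> (E * H)%g = G ->
  'Res[E] ('Ind[G] psi) = 'Ind[E] ('Res[E :&: H] psi).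
Proof.
move=> sHG sEG DG; apply/cfun_inP=> y Ey; rewrite cfResE // cfIndE //.
rewrite -(@Mackey_block E H 1 _ psi) ?invg1 ?conjsg1 // => [|s Ss]; first by rewrite mulg1 DG.
by rewrite conjg1 cfResE ?subsetIr.
Qed.

(** Mackey's formula as an induction principle: double cosets are removed one at
    a time, which avoids choosing representatives of all of them. *)
Lemma Res_Ind_Mackey E H G (psi : 'CF(H)) (P : 'CF(E) -> Prop) :
    H \subset G -> E \subset G -> P 0 -> (forall f1 f2, P f1 -> P f2 -> P (f1 + f2)) ->
    (forall x, x \in G -> P ('Ind[E] ('Res[E :&: H :^ x] (cfIsom (conj_isom H x) psi)))) ->
  P ('Res[E] ('Ind[G] psi)).
Proof.
move=> sHG sEG P0 PD PI.
suffices PX (X : {set gT}) (f : 'CF(E)) : X \subset G -> (E * X * H)%g = X ->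
    {in E, forall y, f y = #|H|%:R^-1 * (\sum_(z in X) psi (y ^ z)%g)} -> P f.
  apply: (PX G) => // [|y Ey]; last by rewrite cfResE ?cfIndE.
  by rewrite (mulSGid sEG) (mulGSid sHG).
have [n] := ubnP #|X|; elim: n => // n IHn in X f * => /ltnSE le_n sXG EXH Df.
have [X0 | [x Xx]] := set_0Vmem X.
  suffices -> : f = 0 by [].
  by apply/cfun_inP=> y Ey; rewrite Df // X0 big_set0 mulr0 cfunE.
have Gx := subsetP sXG x Xx; pose D := ((E :* x) * H)%g.
have sDX : D \subset X by rewrite -EXH mulSg // mulgS // sub1set.
pose f1 := 'Ind[E] ('Res[E :&: H :^ x^-1%g] (cfIsom (conj_isom H x^-1%g) psi)).
rewrite -[f](subrK f1) addrC; apply: PD; first exact/PI/groupVr.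
apply: (IHn (X :\: D)).
- apply: leq_trans le_n; rewrite [X in (_ < X)%N](cardsD1 x) Xx ltnS subset_leq_card //.
  apply: setDS; rewrite sub1set -[x]mulg1; apply: mem_mulg => //.
  by rewrite rcoset_refl.
- exact: subset_trans (subsetDl _ _) sXG.
- apply/eqP; rewrite eqEsubset; apply/andP; split; last first.
    by apply/subsetP=> z Xz; rewrite -[z]mulg1 -[z]mul1g !mem_mulg.
  apply/subsetP=> _ /mulsgP[_ t /mulsgP[e z Ee /setDP[Xz D'z] ->] Ht ->].
  apply/setDP; split; first by rewrite -EXH !mem_mulg.
  apply: contra D'z => /mulsgP[_ t1 /rcosetP[e1 Ee1 ->] Ht1 E1].
  apply/mulsgP; exists (e^-1 * e1 * x)%g (t1 * t^-1)%g; rewrite ?groupM ?groupV //.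
    by rewrite mem_rcoset mulgK groupM ?groupV.
  by rewrite -!mulgA (mulgA x) (mulgA e1) (mulgA e1) -E1 !mulgA mulVg mul1g mulgK.
move=> y Ey; rewrite !cfunE Df // (big_setID D) /= (setIidPr sDX) mulrDr addrC.
have -> : f1 y = #|H|%:R^-1 * (\sum_(z in D) psi (y ^ z)%g).
  symmetry; apply: Mackey_block => // s Ss.
  have [Es Hs] := setIP Ss; rewrite cfResE ?subsetIr //.
  by rewrite -[s in LHS](conjgK x) cfIsomE -?mem_conjgV.
by rewrite addKr.
Qed.

(** * Characters of solvable groups restricted to nilpotent subgroups *)

(** Sums of characters induced from subgroups H above U that satisfy the bound
    #|H|_p <= B / c, written without a division; with U trivial, c = chi(1)_p and
    B = #|G|_p, the bound is (#|G| / chi(1))_p. *)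
Inductive small_induced (p c B : nat) U (t : Iirr U) E : 'CF(E) -> Prop :=
| SmallInduced0 : small_induced p c B t 0
| SmallInducedD H (h : Iirr H) f of U \subset H & H \subset E & homogeneous t 'chi_h
    & (#|H|`_p * c <= B)%N & small_induced p c B t f :
    small_induced p c B t ('Ind[E] 'chi_h + f).

Section SmallInd.
Variables (p c B : nat) (U : {group gT}) (t : Iirr U).

Lemma small_inducedD E (f1 f2 : 'CF(E)) :
  small_induced p c B t f1 -> small_induced p c B t f2 -> small_induced p c B t (f1 + f2).
Proof.
by move=> + sf2; elim=> [|H h f sUH sHE th le_B sf IH]; rewrite ?add0r // -addrA; constructor.
Qed.

Lemma small_induced1 E H (h : Iirr H) :
    U \subset H -> H \subset E -> homogeneous t 'chi_h -> (#|H|`_p * c <= B)%N ->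
  small_induced p c B t ('Ind[E] 'chi_h).
Proof. by move=> *; rewrite -[X in small_induced _ _ _ _ X]addr0; do !constructor. Qed.

Lemma small_induced_char E (f : 'CF(E)) : f \is a character ->
    (forall k, k \in irr_constt f -> small_induced p c B t 'chi_k) ->
  small_induced p c B t f.
Proof.
move=> Nf sf; rewrite [f]cfun_sum_constt.
apply: big_ind => [|f1 f2|k fk]; [exact: SmallInduced0 | exact: small_inducedD | ].
have /natrP[n ->] := Cnat_cfdot_char Nf (irr_char k).
elim: n => [|n IHn]; first by rewrite scale0r; apply: SmallInduced0.
by rewrite -addn1 natrD scalerDl scale1r; apply: small_inducedD => //; apply: sf.
Qed.

Lemma small_induced_Ind c1 B1 E E1 (f : 'CF(E1)) : E1 \subset E ->
    (forall m, m * c1 <= B1 -> m * c <= B)%N ->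
  small_induced p c1 B1 t f -> small_induced p c B t ('Ind[E] f).
Proof.
move=> sE1E le_B; elim=> [|H h f1 sUH sHE1 th /le_B le_BH _ IH].
  by rewrite linear0; apply: SmallInduced0.
rewrite linearD /= cfIndInd //; apply: SmallInducedD => //.
exact: subset_trans sE1E.
Qed.

End SmallInd.

Lemma deg_Ind G H (i : Iirr G) (j : Iirr H) :
  H \subset G -> 'chi_i = 'Ind[G] 'chi_j -> deg i = (#|G : H| * deg j)%N.
Proof.
move=> sHG Di; apply/eqP; rewrite -(eqr_nat algC) natrM -!irr1_degree.
by rewrite Di cfInd1.
Qed.

Lemma deg_Res G H (i : Iirr G) (j : Iirr H) : 'Res[H] 'chi_i = 'chi_j -> deg i = deg j.
Proof.
by move=> Dj; apply/eqP; rewrite -(eqr_nat algC) -!irr1_degree -Dj cfRes1.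
Qed.

Lemma deg_rel_monomial E U (k : Iirr E) (t : Iirr U) :
    U <| E -> nilpotent (E / U) -> homogeneous t 'chi_k ->
  exists H, exists h : Iirr H, [/\ U \subset H, H \subset E, 'chi_k = 'Ind[E] 'chi_h,
    homogeneous t 'chi_h & deg k = (#|E : H| * deg t)%N].
Proof.
move=> nsUE nilE tk; have [H [h [sUH sHE Dk irrh]]] := nilpotent_rel_monomial k nsUE nilE.
have th := homogeneous_sub sUH sHE tk (Ind_irr_constt Dk).
exists H, h; split=> //; rewrite (deg_Ind sHE Dk).
by rewrite (deg_Res (homogeneous_irr th irrh)).
Qed.

(** If q differs from p, then 'chi_f and 'chi_t have the same p-part of the degree.
    If q = p, let P1 / U be the Sylow p-subgroup of E / U, m a constituent of 'chi_k
    on P1, and s a constituent of 'chi_i on P1 M whose restriction involves m.  Then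
    s lies over f, so that deg f <= deg s <= #|P1 M : P1| * deg m, and
    #|P1 M : P1|, deg f / deg t and deg m / deg t are powers of p. *)
Lemma deg_part_le_index (p q : nat) G M U E (i : Iirr G) (f : Iirr M) (t : Iirr U) (k : Iirr E) :
    prime p -> U <| G -> M <| G -> U \subset M -> E \subset G -> U \subset E ->
    (E * M)%g = G -> nilpotent (E / U) -> q.-group (M / U) -> prime q ->
    homogeneous f 'chi_i -> homogeneous t 'chi_i -> k \in irr_constt ('Res[E] 'chi_i) ->
  ((deg f)`_p * #|E|`_p <= #|G|`_p * (deg k)`_p)%N.
Proof.
move=> pr_p nsUG nsMG sUM sEG sUE DG nilE qM pr_q fi ti ik.
have nsUE : U <| E := normalS sUE sEG nsUG.
have [sUG sMG] := (normal_sub nsUG, normal_sub nsMG).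
have nsUM : U <| M := normalS sUM sMG nsUG.
have fK := homogeneous_constt fi.
have tf : homogeneous t 'chi_f := homogeneous_sub sUM sMG ti fK.
have tk : homogeneous t 'chi_k := homogeneous_sub sUE sEG ti ik.
have [H1 [_ [sUH1 sH1M _ _ Df]]] := deg_rel_monomial nsUM (pgroup_nil qM) tf.
have [H2 [_ [sUH2 sH2E _ _ Dk]]] := deg_rel_monomial nsUE nilE tk.
have qMU : q.-nat #|M : U| by rewrite -card_quotient ?normal_norm.
have qMH1 : q.-nat #|M : H1| by apply: pnat_dvd (indexgS M sUH1) qMU.
have deg_gt0 (A : {group gT}) (j : Iirr A) : (0 < deg j)%N by apply: irr_degree_gt0.
have [p'q | Dq] := eqVneq p q; last first.
  have -> : ((deg f)`_p = (deg t)`_p)%N.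
    rewrite Df partnM // part_p'nat ?mul1n //.
    by apply: sub_in_pnat qMH1 => l _; rewrite !inE => /eqP->; rewrite eq_sym.
  rewrite mulnC leq_mul //; first by apply: dvdn_leq; rewrite ?part_gt0 // partn_dvd ?cardG_gt0 // cardSg.
  by apply: dvdn_leq; rewrite ?part_gt0 // partn_dvd ?deg_gt0 // Dk dvdn_mull.
subst q; have [P1 DP1 sUP1 nsP1E] := inv_quotientN nsUE (pcore_normal p (E / U)).
have sP1E := normal_sub nsP1E; have sP1G := subset_trans sP1E sEG.
have nsUP1 : U <| P1 := normalS sUP1 sP1E nsUE.
have pP1 : p.-group (P1 / U) by rewrite -DP1 pcore_pgroup.
have [m km] := constt_cfRes_irr P1 k.
have tm : homogeneous t 'chi_m := homogeneous_sub sUP1 sP1E tk km.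
have [H3 [_ [sUH3 sH3P1 _ _ Dm]]] := deg_rel_monomial nsUP1 (pgroup_nil pP1) tm.
have pP1U : p.-nat #|P1 : U| by rewrite -card_quotient ?normal_norm.
have pP1H3 : p.-nat #|P1 : H3| by apply: pnat_dvd (indexgS P1 sUH3) pP1U.
have le_mk : ((deg m)`_p <= (deg k)`_p)%N.
  apply: dvdn_leq; rewrite ?part_gt0 // partn_dvd ?deg_gt0 //.
  have := dvdn_constt_Res1_irr1 nsP1E km; case=> n; rewrite !irr1_degree -natrM => /eqP.
  by rewrite eqr_nat => /eqP->; rewrite dvdn_mull.
pose PM := (P1 <*> M)%G.
have nMP1 : P1 \subset 'N(M) by apply: subset_trans sP1G (normal_norm nsMG).
have DPM : (P1 * M)%g = PM by rewrite /= norm_joinEl.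
have sPMG : PM \subset G by rewrite join_subG sP1G.
have [sP1PM sMPM] : P1 \subset PM /\ M \subset PM by rewrite joing_subl joing_subr.
have im : m \in irr_constt ('Res[P1] ('Res[PM] 'chi_i)).
  rewrite cfResRes // -(cfResRes _ sP1E sEG); apply: constt_Res_trans ik _ km.
  by rewrite cfRes_char ?irr_char.
have [s is_ sm] := constt_Res_split (cfRes_char _ (irr_char i)) im.
have fs : f \in irr_constt ('Res[M] 'chi_s) := homogeneous_constt (homogeneous_sub sMPM sPMG fi is_).
have le_fs : (deg f <= deg s)%N.
  rewrite -(ler_nat algC) -!irr1_degree -(cfRes1 M 'chi_s) char1_ge_constt //.
  by rewrite cfRes_char ?irr_char.
have le_sm : (deg s <= #|PM : P1| * deg m)%N.
  rewrite -(ler_nat algC) natrM -!irr1_degree -(cfInd1 'chi_m sP1PM) char1_ge_constt //.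
    by rewrite cfInd_char ?irr_char.
  by rewrite constt_Ind_Res.
have pPM : p.-nat #|PM : P1|.
  rewrite -DPM indexMg -indexgI; apply: pnat_dvd (indexgS M _) qMU.
  by rewrite subsetI sUM.
have cE : (#|E|`_p = #|P1|`_p)%N.
  rewrite -(Lagrange sP1E) partnM ?cardG_gt0 // [X in (_ * X)%N]part_p'nat ?muln1 //.
  have := nilpotent_pcore_Hall p nilE; rewrite /pHall => /and3P[_ _]; rewrite DP1.
  by rewrite index_quotient_eq // ?normal_norm // subIset ?sUP1 ?orbT.
have key : (#|M : H1| <= #|PM : P1| * #|P1 : H3|)%N.
  rewrite -(leq_pmul2r (deg_gt0 _ t)) -Df -mulnA -Dm.
  exact: leq_trans le_fs le_sm.
have Efp : ((deg f)`_p = #|M : H1| * (deg t)`_p)%N by rewrite Df partnM // part_pnat_id.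
have Emp : ((deg m)`_p = #|P1 : H3| * (deg t)`_p)%N by rewrite Dm partnM // part_pnat_id.
rewrite Efp cE; apply: (@leq_trans (#|PM : P1| * #|P1|`_p * (deg m)`_p)%N).
  by rewrite Emp [leqRHS](_ : _ = (#|PM : P1| * #|P1 : H3|) * ((deg t)`_p * #|P1|`_p))%N; [rewrite -mulnA leq_mul2r key orbT | ring].
rewrite leq_mul //; apply: dvdn_leq; rewrite ?part_gt0 //.
rewrite -{1}(part_pnat_id pPM) -partnM ?cardG_gt0 // partn_dvd ?cardG_gt0 //.
by rewrite mulnC Lagrange // cardSg.
Qed.

(** Induction on #|G : U|, through a minimal normal subgroup M / U of G / U and a
    constituent f of the restriction of 'chi_i to M. *)
Theorem solvable_Res_small_induced (p : nat) G U E (i : Iirr G) (t : Iirr U) :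
    prime p -> U <| G -> solvable (G / U) -> homogeneous t 'chi_i ->
    U \subset E -> E \subset G -> nilpotent (E / U) ->
  small_induced p ((deg i)`_p) (#|G|`_p * (deg t)`_p) t ('Res[E] 'chi_i).
Proof.
move=> pr_p; have [n] := ubnP #|G : U|.
elim: n => // n IHn in G U E i t * => /ltnSE le_n nsUG solG ti sUE sEG nilE.
have sUG := normal_sub nsUG.
have deg_gt0 (A : {group gT}) (j : Iirr A) : (0 < deg j)%N by apply: irr_degree_gt0.
have [trG | ntG] := eqVneq (G / U)%g 1%g.
  have DG : G = U.
    by apply/val_inj/eqP; rewrite /= eqEsubset sUG andbT -quotient_sub1 ?normal_norm // trG.
  case: _ / DG in t nsUG solG ti sUE sEG nilE le_n trG *.
  have DE : G = E by apply/val_inj/eqP; rewrite /= eqEsubset sEG sUE.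
  case: _ / DE in sUE sEG nilE *.
  rewrite cfRes_id -[X in small_induced _ _ _ _ X]cfInd_id; apply: small_induced1 => //.
  have := homogeneous_constt ti; rewrite cfRes_id constt_irr inE => /eqP->.
  exact: leqnn.
have [Mb minMb sMbG] := minnormal_exists ntG (normG (G / U)).
have [nMbG ntMb abMb] := minnormal_solvable minMb sMbG solG.
have [q pr_q /abelem_pgroup qMb] := is_abelemP abMb.
have nsMbG : Mb <| G / U by apply/andP.
have [M DMb sUM nsMG] := inv_quotientN nsUG nsMbG; have sMG := normal_sub nsMG.
have nsUM : U <| M := normalS sUM sMG nsUG.
have qM : q.-group (M / U) by rewrite -DMb.
have iMU : (1 < #|M : U|)%N by rewrite -card_quotient ?normal_norm // -DMb cardG_gt1.
have [f fi] := constt_cfRes_irr M i.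
have [fhi | [T [sMT ltTG [j Di]]]] := Clifford_cases nsMG fi; last first.
  (* 'chi_i is induced from T, hence from all the conjugates of T; the induction *)
  (* hypothesis applies to these, and Mackey's formula transfers it to E.        *)
  have sTG := proper_sub ltTG.
  rewrite Di; apply: (Res_Ind_Mackey sTG sEG) => [|f1 f2|x Gx].
  - exact: SmallInduced0.
  - exact: small_inducedD.
  rewrite -isom_IirrE; set jx := isom_Iirr _ j.
  have Dix : 'chi_i = 'Ind[G] 'chi_jx by rewrite isom_IirrE cfInd_conj.
  have sTxG : T :^ x \subset G by rewrite -(conjGid Gx) conjSg.
  have sUTx : U \subset T :^ x.
    by rewrite -(normsP (normal_norm nsUG) x Gx) conjSg (subset_trans sUM).
  have nsUTx : U <| (T :^ x)%G := normalS sUTx sTxG nsUG.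
  have tjx : homogeneous t 'chi_jx := homogeneous_sub sUTx sTxG ti (Ind_irr_constt Dix).
  have ltTxG : ((T :^ x)%G \proper G) by rewrite -(conjGid Gx) properJ.
  have [sEx1 sEx2] : E :&: T :^ x \subset E /\ E :&: T :^ x \subset T :^ x.
    by rewrite subsetIl subsetIr.
  have sUEx : U \subset E :&: T :^ x by rewrite subsetI sUE.
  apply: (small_induced_Ind sEx1 _ (IHn (T :^ x)%G U (E :&: T :^ x)%G jx t _ nsUTx _ tjx sUEx sEx2 _)).
  - move=> m le_m; rewrite (deg_Ind sTxG Dix) partnM ?deg_gt0 //.
    rewrite -(Lagrange sTxG) partnM ?cardG_gt0 // mulnCA mulnAC [leqRHS]mulnC.
    by rewrite leq_mul2l le_m orbT.
  - by apply: leq_trans le_n; apply: index_lt_proper.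
  - exact: solvableS (quotientS _ sTxG) solG.
  - exact: nilpotentS (quotientS _ sEx1) nilE.
have tf : homogeneous t 'chi_f := homogeneous_sub sUM sMG ti fi.
pose EM := (E <*> M)%G.
have nME : E \subset 'N(M) by apply: subset_trans sEG (normal_norm nsMG).
have DEM : (E * M)%g = EM by rewrite /= norm_joinEl.
have sEMG : EM \subset G by rewrite join_subG sEG.
have [sEEM sMEM] : E \subset EM /\ M \subset EM by rewrite joing_subl joing_subr.
have nilEM : nilpotent (EM / M).
  rewrite /= quotientYidr //.
  have nsME : M :&: E <| E by rewrite setIC; apply: normalGI sEG nsMG.
  have := second_isog nME => /isog_nil <-.
  have sUME : U \subset M :&: E by rewrite subsetI sUM.
  have := third_isog sUME (normalS sUE sEG nsUG) nsME => /isog_nil <-; exact: quotient_nil.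
have solM : solvable (G / M).
  have := third_isog sUM nsUG nsMG => /isog_sol <-; exact: quotient_sol.
have lt_M : (#|G : M| < n)%N.
  apply: leq_trans le_n; rewrite -(Lagrange_index sMG sUM) ltn_Pmulr ?indexg_gt0 //.
(* f is invariant: take M in place of U, then restrict from E M to E and      *)
(* decompose the restriction to E of the characters of H, where H contains M.  *)
have := IHn G M EM i f lt_M nsMG solM fhi sMEM sEMG nilEM.
rewrite -(cfResRes _ sEEM sEMG).
elim=> [|H h f1 sMH sHEM fh le_H _ IH1]; first by rewrite linear0; apply: SmallInduced0.
rewrite linearD; apply: small_inducedD => //=.
have DEH : (E * H)%g = EM.
  by apply/eqP; rewrite eqEsubset mul_subG //= -DEM mulgS.
rewrite (Res_Ind_mulg _ sHEM sEEM DEH).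
have [sEHE sEHH] : E :&: H \subset E /\ E :&: H \subset H by rewrite subsetIl subsetIr.
have sUH := subset_trans sUM sMH.
have sUEH : U \subset E :&: H by rewrite subsetI sUE.
have sHG := subset_trans sHEM sEMG; have sEHG := subset_trans sEHE sEG.
have th : homogeneous t 'chi_h.
  move=> l; rewrite -(cfResRes _ sUM sMH) => hl.
  have [f' hf' f'l] := constt_Res_split (cfRes_char _ (irr_char h)) hl.
  by move: (fh _ hf') => /eqP Df'; rewrite Df' in f'l; apply: tf.
have nilEH : nilpotent ((E :&: H) / U) := nilpotentS (quotientS _ sEHE) nilE.
apply: (@small_induced_Ind _ _ _ _ _ ((deg i)`_p)%N (#|G|`_p * (deg t)`_p)%N) => //.
apply: small_induced_char => [|k hk]; first by rewrite cfRes_char ?irr_char.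
have tk : homogeneous t 'chi_k := homogeneous_sub sUEH sEHH th hk.
have [H' [h' [sUH' sH'EH Dk th' dk]]] := deg_rel_monomial (normalS sUEH sEHG nsUG) nilEH tk.
rewrite Dk; apply: small_induced1 => //.
have DH : ((E :&: H) * M)%g = H.
  by rewrite setIC group_modr // DEM (setIidPl sHEM).
have le_X := deg_part_le_index pr_p (normalS sUH sHG nsUG) (normalS sMH sHG nsMG) sUM sEHH sUEH DH nilEH qM pr_q fh th hk.
have part_gt0' (A : {group gT}) (j : Iirr A) : (0 < (deg j)`_p)%N by rewrite part_gt0.
have Ek : (#|H'|`_p * (deg k)`_p = #|E :&: H|`_p * (deg t)`_p)%N.
  by rewrite -!partnM ?cardG_gt0 ?deg_gt0 // dk mulnA Lagrange.
rewrite -(leq_pmul2l (part_gt0' M f)) -(leq_pmul2r (part_gt0' (E :&: H)%G k)).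
set c := ((deg i)`_p)%N in le_H *; set a := ((deg t)`_p)%N in Ek *.
set b := ((deg f)`_p)%N in le_X le_H *; set d := ((deg k)`_p)%N in le_X Ek *.
apply: (@leq_trans (b * #|E :&: H|`_p * (a * c))%N).
  by rewrite [leqLHS](_ : _ = b * c * (#|H'|`_p * d))%N; [rewrite Ek leq_eqVlt; apply/orP; left; apply/eqP; ring | ring].
apply: (@leq_trans (#|H|`_p * d * (a * c))%N); first by rewrite leq_mul2r le_X orbT.
rewrite [leqLHS](_ : _ = #|H|`_p * c * (d * a))%N; last by ring.
by rewrite [leqRHS](_ : _ = #|G|`_p * b * (d * a))%N; [rewrite leq_mul2r le_H orbT | ring].
Qed.

End Relative.

(** * Divisibility for solvable groups *)

Section Shift.
Variables (gT : finGroupType) (G Z : {group gT}) (g : gT) (p : nat).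
Hypotheses (Gg : g \in G) (sZg : Z \subset <[g]>) (pZ : p.-group Z).
Hypothesis gZ : forall z, z \in Z -> (g * z)%g \in g ^: G.

Lemma shift_cycle z : z \in Z -> <[g * z]> = <[g]>.
Proof.
move=> Zz; apply/eqP; rewrite eqEcard cycle_subG groupM ?cycle_id ?(subsetP sZg) //=.
by have /imsetP[x _ ->] := gZ Zz; rewrite cycleJ cardJg.
Qed.

(** The restriction of psi to <[g]> is a sum of linear characters, and a linear
    character of <[g]> sums over g Z to #|Z| times its value at g, or to 0. *)
Lemma shift_coset_sum (H : {group gT}) (psi : 'CF(H)) : psi \is a character ->
  (\sum_(y in (g *: Z)%g) psi y) / #|Z|%:R \in Aint.
Proof.
move=> Npsi; rewrite -lcosetE /lcoset big_imset /=; last by move=> ? ? _ _; apply: mulgI.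
have [Hg | H'g] := boolP (g \in H); last first.
  rewrite big1 ?mul0r // => z Zz; apply: cfun0; apply: contra H'g.
  by rewrite -!cycle_subG shift_cycle.
have sgH : <[g]> \subset H by rewrite cycle_subG.
rewrite (eq_bigr (fun z => ('Res[<[g]>] psi) (g * z)%g)) => [|z Zz]; last first.
  by rewrite cfResE // groupM ?cycle_id ?(subsetP sZg).
have [r ->] := char_sum_irr (cfRes_char <[g]> Npsi).
under eq_bigr do rewrite sum_cfunE.
rewrite exchange_big mulr_suml rpred_sum // => i _.
have lin_i : 'chi_i \is a linear_char by rewrite irr_cyclic_lin ?cycle_cyclic.
under eq_bigr => z Zz do rewrite lin_charM ?cycle_id ?(subsetP sZg) //.
rewrite -mulr_sumr -mulrA rpredM ?Aint_irr //.
have -> : (\sum_(z in Z) 'chi_i z) / #|Z|%:R = '['Res[Z] 'chi_i, 1].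
  rewrite cfdotE mulrC; congr (_ * _); apply: eq_bigr => z Zz.
  by rewrite cfun1E Zz conjC1 mulr1 cfResE.
by rewrite Aint_Cnat // Cnat_cfdot_char ?cfRes_char ?irr_char ?rpred1.
Qed.

Let A := (g *: Z)%g.
Let N0 := 'N_G(A).

Lemma shift_norm_cent : 'C_G[g] \subset N0.
Proof.
apply: setIS; apply/subsetP=> y Cy; rewrite inE; apply/subsetP=> _ /imsetP[_ /lcosetP[z Zz ->] ->].
have cyg : y \in 'C(<[g]>) by rewrite cent_cycle.
rewrite (_ : (g * z) ^ y = g * z)%g ?mem_lcoset ?mulKg //.
apply/conjg_fixP/commgP; apply: commute_sym; apply: (centP cyg).
by rewrite groupM ?cycle_id ?(subsetP sZg).
Qed.

Lemma shift_class : g ^: N0 = A.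
Proof.
have Ag : g \in A by rewrite lcoset_refl.
apply/setP=> x; apply/idP/idP => [/imsetP[y /setIP[_ Ny] ->] | /lcosetP[z Zz ->]].
  by rewrite -(normP Ny) memJ_conjg.
have /imsetP[y Gy Dy] := gZ Zz; rewrite Dy imset_f // inE Gy /=; apply/normP.
have sZyg : Z :^ y \subset <[g]> by rewrite -(shift_cycle Zz) Dy cycleJ conjSg.
have DZ : Z :^ y = Z.
  by apply/eqP; rewrite (eq_subG_cyclic (cycle_cyclic g)) ?cardJg.
by rewrite /A conjsMg conjg_set1 DZ -Dy lcosetM (lcoset_id Zz).
Qed.

(** The normalizer of g Z acts on g Z by conjugation, transitively. *)
Lemma card_shift_norm : #|N0| = (#|Z| * #|'C_G[g]|)%N.
Proof.
have -> : 'C_G[g] = 'C_N0[g].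
  by apply/eqP; rewrite eqEsubset subsetI shift_norm_cent subsetIr setSI ?subsetIl.
rewrite -(@Lagrange _ N0 'C_N0[g]) ?subsetIl // mulnC; congr (_ * _)%N.
by rewrite index_cent1 shift_class card_lcoset.
Qed.

(** All the elements of g Z have the same p'-part. *)
Lemma shift_norm_constt y : y \in N0 -> (g.`_p^' ^ y = g.`_p^')%g.
Proof.
move=> Ny; have: (g ^ y)%g \in A by rewrite -shift_class imset_f.
case/lcosetP=> z Zz Dz; rewrite -consttJ Dz consttM.
  have /constt1P -> : p^'^'.-elt z by rewrite p_eltNK (mem_p_elt pZ).
  by rewrite mulg1.
have /cyclePmin[k _ ->] := subsetP sZg z Zz; exact: commuteX.
Qed.

Lemma shift_sum_Ind (E H : {group gT}) (psi : 'CF(H)) :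
    H \subset E -> E \subset N0 -> psi \is a character ->
  exists2 a, a \in Aint & \sum_(y in A) 'Ind[E] psi y = (#|E : H| * #|Z|)%:R * a.
Proof.
move=> sHE sEN Npsi; exists ((\sum_(y in A) psi y) / #|Z|%:R); first exact: shift_coset_sum.
rewrite natrM -mulrA [#|Z|%:R * _]mulrC divfK ?neq0CG //.
under eq_bigr do rewrite cfIndE //.
rewrite -mulr_sumr exchange_big /= (eq_bigr (fun _ => \sum_(y in A) psi y)).
  by rewrite sumr_const -[X in _ * X]mulr_natl mulrA natf_indexg // (mulrC #|H|%:R^-1).
move=> x Ex; have /setIP[_ Nx] := subsetP sEN x Ex.
rewrite [RHS](reindex_inj (conjg_inj x)); apply: eq_bigl => y.
by rewrite -{2}(normP Nx) memJ_conjg.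
Qed.

(** As #|H|_p, c and B are powers of p, the bound on #|H|_p in small_induced is a
    divisibility. *)
Lemma shift_sum_small_induced (E U : {group gT}) (t : Iirr U) (c B : nat) (f : 'CF(E)) :
    prime p -> E \subset N0 -> (exists b, c = p ^ b)%N -> (exists b, B = p ^ b)%N ->
    small_induced p c B t f ->
  exists2 a, a \in Aint & B%:R * (\sum_(y in A) f y) = (#|E|`_p * c * #|Z|)%:R * a.
Proof.
move=> pr_p sEN [b Dc] [d DB]; elim=> [|H h f1 _ sHE _ le_B _ [a1 Aa1 D1]].
  by exists 0; rewrite // mulr0 big1 ?mulr0 // => y _; rewrite cfunE.
have [a Aa Da] := shift_sum_Ind sHE sEN (irr_char h).
have /dvdnP[k Dk] : (#|E|`_p * c %| B * #|E : H|)%N.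
  rewrite -(Lagrange sHE) partnM ?cardG_gt0 // mulnAC dvdn_mul ?dvdn_part //.
  move: le_B; rewrite DB Dc p_part -expnD => le_B; rewrite dvdn_exp2l //.
  by rewrite -(leq_exp2l _ _ (prime_gt1 pr_p)).
exists (k%:R * a + a1); first by rewrite rpredD ?rpredM ?rpred_nat.
under eq_bigr do rewrite cfunE.
rewrite big_split mulrDr /= D1 Da mulrDr; congr (_ + _).
by rewrite !mulrA -!natrM mulnA Dk; congr (_%:R * _); ring.
Qed.

Lemma homogeneous_trivial (i : Iirr G) : exists2 t : Iirr 1%G, homogeneous t 'chi_i & deg t = 1%N.
Proof.
exists 0; last by apply/eqP; rewrite -(eqr_nat algC) -irr1_degree irr0 cfun11.
move=> k _; rewrite inE; apply/eqP/val_inj => /=.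
have N1 : Nirr (1%G : {group gT}) = 1%N.
  have := card_classes_abelian (1%G : {group gT}).
  by rewrite abelian1 cards1 -NirrE => /esym/eqP.
by have := ltn_ord k; move: (nat_of_ord k) => m; rewrite N1; case: m.
Qed.

(** The sum of 'chi_i over g Z, computed in the nilpotent group E, gives the
    divisibility up to factors prime to p, which are harmless because omega 'chi_i g
    is an algebraic integer. *)
Theorem solvable_shift_dvd (i : Iirr G) : prime p -> solvable G ->
  omega 'chi_i g / #|Z|%:R \in Aint.
Proof.
move=> pr_p solG; have [t ti dt] := homogeneous_trivial i.
have sNG : N0 \subset G by apply: subsetIl.
have sgN : <[g]> \subset N0.
  by apply: subset_trans shift_norm_cent; rewrite cycle_subG inE Gg cent1id.
pose s := (g.`_p^')%g; pose u := (g.`_p)%g.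
have sN : s \in N0 by rewrite (subsetP sgN) // mem_cycle.
have uN : u \in N0 by rewrite (subsetP sgN) // mem_cycle.
have [P sylP suP] : {P : {group gT} | p.-Sylow(N0) P & <[u]> \subset P}.
  by apply: Sylow_superset; rewrite ?cycle_subG //; apply: p_elt_constt.
have sPN := pHall_sub sylP; have pP := pHall_pgroup sylP.
have cPs : P \subset 'C(<[s]>).
  rewrite centsC cycle_subG; apply/centP=> y Py; apply/commgP/conjg_fixP.
  by rewrite shift_norm_constt // (subsetP sPN).
pose E := (<[s]> <*> P)%G.
have DE : (<[s]> * P)%g = E by rewrite /= cent_joinEr.
have sEN : E \subset N0 by rewrite join_subG cycle_subG sN.
have nilE : nilpotent E.
  by rewrite -DE mulg_nil // (pgroup_nil pP) abelian_nil ?cycle_abelian.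
have cE : (#|E|`_p = #|N0|`_p)%N.
  have p's : p^'.-nat #|<[s]>| by apply: p_elt_constt.
  rewrite -DE coprime_cardMg ?partnM ?cardG_gt0 //; last by rewrite coprime_sym (pnat_coprime pP p's).
  by rewrite part_p'nat // mul1n part_pnat_id // (card_Hall sylP).
have nil1 (K : {group gT}) : isog K (K / 1) by apply: quotient1_isog.
have := @solvable_Res_small_induced gT p G 1%G E i t pr_p (normal1 G).
rewrite -(isog_sol (nil1 G)) -(isog_nil (nil1 E)) dt partn1 muln1.
move=> /(_ solG ti (sub1G _) (subset_trans sEN sNG) nilE) sm.
have [||a Aa Da] := shift_sum_small_induced pr_p sEN _ _ sm.
- by exists (logn p (deg i)); rewrite p_part.
- by exists (logn p #|G|); rewrite p_part.
(* g and Z are in E, and 'chi_i is constant on g Z. *)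
have EA : \sum_(y in A) ('Res[E] 'chi_i) y = #|Z|%:R * 'chi_i g.
  have sgE : A \subset E.
    have gE : g \in E.
      rewrite -[g](consttC p) -DE -(centC cPs) mem_mulg //.
        by rewrite (subsetP suP) // cycle_id.
      exact: cycle_id.
    apply/subsetP=> _ /lcosetP[z Zz ->]; rewrite groupM //.
    by apply: (subsetP _ z (subsetP sZg z Zz)); rewrite cycle_subG.
  rewrite (eq_bigr (fun _ => 'chi_i g)) => [|y Ay].
    by rewrite sumr_const card_lcoset mulr_natl.
  rewrite cfResE ?(subset_trans sEN) ?(subsetP sgE) //.
  have /lcosetP[z Zz ->] := Ay; have /imsetP[x Gx ->] := gZ Zz.
  by rewrite cfunJ.
move: Da; rewrite EA cE card_shift_norm partnM ?cardG_gt0 // (part_pnat_id pZ) => Da.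
have dg := irr_degree_gt0 (socle_of_Iirr i).
set x := _ / _; apply: (@Aint_coprime_mul (#|'C_G[g]|`_p^' * (deg i)`_p^') #|Z|).
- by rewrite coprime_sym; apply: pnat_coprime pZ _; rewrite pnatM !part_pnat.
- suffices ->: (#|'C_G[g]|`_p^' * (deg i)`_p^')%:R * x = (#|G|`_p^')%:R * a.
    by rewrite rpredM ?rpred_nat.
  have nzs n (pi : nat_pred) : (n`_pi)%:R != 0 :> algC by rewrite pnatr_eq0 -lt0n part_gt0.
  have nzZ := neq0CG Z.
  rewrite /x /omega irr1_degree -index_cent1 natf_indexg ?subsetIl //.
  have -> : #|G|%:R = (#|G|`_p)%:R * (#|G|`_p^')%:R :> algC by rewrite -natrM partnC.
  have -> : #|'C_G[g]|%:R = (#|'C_G[g]|`_p)%:R * (#|'C_G[g]|`_p^')%:R :> algC.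
    by rewrite -natrM partnC.
  have -> : (deg i)%:R = ((deg i)`_p)%:R * ((deg i)`_p^')%:R :> algC by rewrite -natrM partnC.
  move: Da; rewrite !natrM => Da.
  have {}Da : (#|G|`_p)%:R * 'chi_i g
      = (#|'C_G[g]|`_p)%:R * ((deg i)`_p)%:R * #|Z|%:R * a.
    by apply: (mulfI nzZ); rewrite mulrCA Da !mulrA.
  transitivity ((#|G|`_p^')%:R * ((#|G|`_p)%:R * 'chi_i g)
      / ((#|'C_G[g]|`_p)%:R * ((deg i)`_p)%:R * #|Z|%:R)); last rewrite Da.
    by field; rewrite !nzs nzZ.
  by field; rewrite !nzs nzZ.
rewrite mulrC divfK ?neq0CG // /omega; exact: Aint_class_div_irr1.
Qed.

End Shift.

(** * Localization of the algebraic integers at a maximal ideal *)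

Section Localization.
Variables (p : nat) (M : algC -> Prop).
Hypotheses (pr_p : prime p) (maxM : Aint_maximal_over p M).

Let idM := Aint_maximal_ideal maxM.
Let M_Aint := Aint_ideal_sub idM.
Let M0 := Aint_ideal0 idM.
Let MD := Aint_idealD idM.
Let MM := Aint_idealM idM.
Let notM1 := Aint_maximal_proper maxM.
Let Mp := Aint_maximal_char maxM.

Lemma maxideal_opp x : M x -> M (- x).
Proof. by rewrite -mulN1r; apply: MM; rewrite rpredN1. Qed.

Lemma maxideal_prime a b : a \in Aint -> b \in Aint -> M (a * b) -> M a \/ M b.
Proof.
move=> Aa Ab Mab; have [Ma | notMa] := classic (M a); [by left | right].
pose I x := exists m r, [/\ M m, r \in Aint & x = m + r * a].
have idI : Aint_ideal I.
  split=> [x [m [r [Mm Ar ->]]] | | x y [m1 [r1 [Mm1 Ar1 ->]]] [m2 [r2 [Mm2 Ar2 ->]]]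
           | c x Ac [m [r [Mm Ar ->]]]].
  - by rewrite rpredD ?rpredM // M_Aint.
  - by exists 0, 0; rewrite mul0r addr0 rpred0.
  - by exists (m1 + m2), (r1 + r2); split; [exact: MD | rewrite rpredD | ring].
  by exists (c * m), (c * r); split; [exact: MM | rewrite rpredM | ring].
have [[m [r [Mm Ar D1]]] | notI1] := classic (I 1).
  rewrite -[b]mulr1 D1 mulrDr; apply: MD; first exact: MM.
  by rewrite [b * _](_ : _ = r * (a * b)); [exact: MM | ring].
case: notMa; apply: (Aint_maximalP maxM idI) => // [x Mx | ].
  by exists x, 0; rewrite mul0r addr0 rpred0.
by exists 0, 1; rewrite mul1r add0r rpred1.
Qed.

Lemma maxideal_nat n : M n%:R -> (p %| n)%N.
Proof.
move=> Mn; apply: contraT => p'n; case: notM1.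
have [a _] := Bezoutl n (prime_gt0 pr_p).
have -> : gcdn p n = 1%N by apply/eqP; rewrite -/(coprime p n) prime_coprime.
case/dvdnP=> k Dk; have -> : 1 = k%:R * p%:R - a%:R * n%:R :> algC.
  by rewrite -!natrM -Dk natrD addrK.
by apply: MD; [apply: MM => //; rewrite rpred_nat | apply/maxideal_opp/MM => //; rewrite rpred_nat].
Qed.

Lemma maxideal_exp s n : s \in Aint -> ~ M s -> ~ M (s ^+ n).
Proof.
by move=> As notMs; elim: n => [|n IHn] //; rewrite exprS => /(maxideal_prime As)[|//|//]; rewrite rpredX.
Qed.

(** The localization of the ring of algebraic integers at M. *)
Definition Lint x := exists s, [/\ s \in Aint, ~ M s & s * x \in Aint].

Lemma Lint_Aint x : x \in Aint -> Lint x.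
Proof. by move=> Ax; exists 1; rewrite mul1r rpred1. Qed.

Lemma LintD x y : Lint x -> Lint y -> Lint (x + y).
Proof.
move=> [s [As Ms Asx]] [t [At Mt Aty]]; exists (s * t); split; first by rewrite rpredM.
  by case/(maxideal_prime As At).
by rewrite [_ * _](_ : _ = t * (s * x) + s * (t * y)); [rewrite rpredD // rpredM | ring].
Qed.

Lemma LintM x y : Lint x -> Lint y -> Lint (x * y).
Proof.
move=> [s [As Ms Asx]] [t [At Mt Aty]]; exists (s * t); split; first by rewrite rpredM.
  by case/(maxideal_prime As At).
by rewrite [_ * _](_ : _ = (s * x) * (t * y)); [rewrite rpredM | ring].
Qed.

Lemma Lint_sum I (r : seq I) (P : pred I) F :
  (forall i, P i -> Lint (F i)) -> Lint (\sum_(i <- r | P i) F i).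
Proof. by move=> LF; apply: big_ind => //; [apply/Lint_Aint/rpred0 | exact: LintD]. Qed.

Lemma Lint_inv w : w \in Aint -> ~ M w -> Lint w^-1.
Proof.
move=> Aw Mw; exists w; split=> //; rewrite divff ?rpred1 //.
by apply: contra_notN Mw => /eqP->.
Qed.

Lemma Lint_invn n : ~~ (p %| n)%N -> Lint n%:R^-1.
Proof. by move=> p'n; apply: Lint_inv; [rewrite rpred_nat | apply: contraNnot p'n => /maxideal_nat]. Qed.

(** Let j be the first index at which the coefficient of the minimal polynomial of x
    is not divisible by p.  The terms below j add up to a multiple of p, and the
    others to x ^+ j * s, where s is congruent modulo M to that coefficient. *)
Lemma maxideal_nilpotent x : M x ->
  exists j s, [/\ s \in Aint, ~ M s & s * x ^+ j / p%:R \in Aint].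
Proof.
move=> Mx; have Ax := M_Aint Mx; have [f [Df mon_f] _] := minCpolyP x.
have Zf i : exists c : int, (minCpoly x)`_i = c%:~R.
  by apply/intrP; move: Ax; rewrite /Aint => /polyOverP.
have Mint (c : int) : M c%:~R -> (p %| `|c|)%N.
  case: c => n /= Mc; first exact: maxideal_nat.
  by apply: maxideal_nat; rewrite -[_%:R]opprK; exact: maxideal_opp.
have p_neq0 : p%:R != 0 :> algC by rewrite pnatr_eq0 -lt0n prime_gt0.
have ex_j : exists j, (minCpoly x)`_j / p%:R \notin Aint.
  exists (size (minCpoly x)).-1; rewrite -lead_coefE (monicP (minCpoly_monic x)).
  by rewrite mul1r; apply/negP=> Ap; case: notM1; rewrite -(mulVf p_neq0); apply: MM.
case: (ex_minnP ex_j) => j p'j min_j.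
pose h := \sum_(j <= i < size (minCpoly x)) (minCpoly x)`_i * x ^+ (i - j).
have lt_j : (j < size (minCpoly x))%N.
  by rewrite ltnNge; apply: contra p'j => le_j; rewrite nth_default ?mul0r ?rpred0.
have Af i : (minCpoly x)`_i \in Aint by have [c ->] := Zf i; rewrite Aint_int.
have notMj : ~ M (minCpoly x)`_j.
  move: p'j; have [c ->] := Zf j => p'c /Mint; case/dvdnP=> k Dk; case/negP: p'c.
  rewrite [c]intEsign Dk rmorphM /= PoszM !rmorphM /= -mulrA mulfK //.
  by rewrite rpredM // ?Aint_int.
exists j, h; split.
- by rewrite rpred_sum // => i _; rewrite rpredM ?rpredX.
- rewrite /h big_ltn // subnn expr0 mulr1 => Mh; apply: notMj.
  rewrite -[X in M X](addrK (\sum_(j.+1 <= i < size (minCpoly x)) (minCpoly x)`_i * x ^+ (i - j))).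
  apply: MD => //; apply: maxideal_opp.
  rewrite big_nat; apply: big_ind => // i /andP[lt_ji _].
  rewrite -(subnSK lt_ji) exprS mulrCA mulrC; apply: MM => //.
  by rewrite rpredM ?rpredX.
have := root_minCpoly x; rewrite /root horner_coef -(big_mkord xpredT (fun i => (minCpoly x)`_i * x ^+ i)).
rewrite (@big_cat_nat _ _ _ j) //= 1?ltnW // => /eqP/(canRL (addKr _)).
rewrite addr0 => E; have -> : h * x ^+ j = - \sum_(0 <= i < j) (minCpoly x)`_i * x ^+ i.
  rewrite -E mulr_suml; apply: eq_big_nat => i /andP[le_ji _].
  by rewrite -mulrA -exprD subnK.
rewrite mulNr rpredN mulr_suml big_nat rpred_sum // => i /= lt_ij.
rewrite mulrAC rpredM ?rpredX //; apply: contraT => /min_j.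
by rewrite leqNgt lt_ij.
Qed.

(** The p-adic valuation at M of the powers of an element of M is unbounded. *)
Lemma maxideal_exp_Lint x N : M x -> exists q0, forall q, (q0 <= q)%N -> Lint (x ^+ q / (p ^ N)%:R).
Proof.
move=> Mx; have Ax := M_Aint Mx; have [j [s [As Ms Asx]]] := maxideal_nilpotent Mx.
exists (j * N)%N => q le_q; exists (s ^+ N); split; first by rewrite rpredX.
  exact: maxideal_exp.
rewrite -(subnK le_q) exprD exprM natrX.
rewrite [_ * _](_ : _ = x ^+ (q - j * N) * (s * x ^+ j / p%:R) ^+ N).
  by rewrite rpredM ?rpredX.
rewrite !exprMn exprVn; move: (s ^+ N) (x ^+ j ^+ N) (x ^+ (q - j * N)) (_^-1) => a b c d.
by ring.
Qed.

(** M contains no integer prime to p, so integrality at M excludes p from the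
    denominator of a rational number. *)
Lemma Lint_rat y N : y \in Crat -> Lint y -> (p ^ N)%:R * y \in Aint -> y \in Aint.
Proof.
move=> Qy Ly; elim: N => [|N IHN]; first by rewrite mul1r.
rewrite expnS natrM -mulrA => Ap; apply: IHN; set z := _ * y in Ap *.
have Qz : z \in Crat by rewrite rpredM ?rpred_nat.
have p_neq0 : p%:R != 0 :> algC by rewrite pnatr_eq0 -lt0n prime_gt0.
have [s [As Ms Asz]] : Lint z by apply: LintM => //; apply: Lint_Aint; rewrite rpred_nat.
have Mpz : M (p%:R * z).
  have MsP : M (s * (p%:R * z)) by rewrite mulrCA mulrC; apply: MM.
  by case: (maxideal_prime As Ap MsP).
have /intrP[c Dc] : p%:R * z \in Num.int.
  by apply: Cint_rat_Aint => //; apply: rpredM => //; apply: rpred_nat.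
have Mint : (p %| `|c|)%N.
  case: c Dc => n Dc; first by apply: maxideal_nat; rewrite Dc in Mpz.
  by apply: maxideal_nat; rewrite -[_%:R]opprK; apply: maxideal_opp; rewrite Dc in Mpz.
case/dvdnP: Mint => k Dk; have -> : z = ((-1) ^+ (c < 0)%R * k%:Z)%:~R.
  apply: (mulfI p_neq0); rewrite Dc {1}[c]intEsign Dk PoszM mulrA [LHS]rmorphM mulrC.
  by [].
exact: Aint_int.
Qed.

End Localization.

(** * Integrality at one maximal ideal and Galois conjugation *)

Section Galois.

Lemma coef_prod_XsubC_ind (S : algC -> Prop) (cs : seq algC) :
    S 0 -> S 1 -> (forall x y, S x -> S y -> S (x - y)) ->
    (forall x y, S x -> S y -> S (x * y)) -> (forall c, c \in cs -> S c) ->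
  forall i, S (\prod_(c <- cs) ('X - c%:P))`_i.
Proof.
move=> S0 S1 SB SM; elim: cs => [|c cs IHs] Sc i; first by rewrite big_nil coef1; case: eqP.
have {}IHs := IHs (fun d cs_d => Sc d (@mem_behead _ (c :: cs) d cs_d)).
rewrite big_cons mulrBl coefB coefXM coefCM; apply: SB; first by case: eqP.
by apply: SM => //; apply: Sc; rewrite mem_head.
Qed.

Variables (p : nat) (M : algC -> Prop).
Hypotheses (pr_p : prime p) (maxM : Aint_maximal_over p M).

Lemma aut_char_power (gT : finGroupType) (H : {group gT}) (chi : 'CF(H)) (g : gT)
    (nu : {rmorphism algC -> algC}) : chi \is a character -> g \in H ->
  exists2 k, coprime k #[g] & nu (chi g) = chi (g ^+ k)%g.
Proof.
move=> Nchi Hg; have [w prim_w] := C_prim_root_exists (order_gt0 g).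
have prim_nuw : #[g].-primitive_root (nu w) by rewrite fmorph_primitive_root.
have [k Dk] := prim_rootP prim_w (prim_expr_order prim_nuw).
have co_k : coprime k #[g] by rewrite -(prim_root_exp_coprime _ prim_w) -Dk.
exists k => //; have sgH : <[g]> \subset H by rewrite cycle_subG.
rewrite -!(cfResE _ sgH) ?mem_cycle ?cycle_id //.
have [r ->] := char_sum_irr (cfRes_char <[g]> Nchi).
rewrite !sum_cfunE rmorph_sum; apply: eq_bigr => i _.
have lin_i : 'chi_i \is a linear_char by rewrite irr_cyclic_lin ?cycle_cyclic.
have /(prim_rootP prim_w)[m Dm] : 'chi_i g ^+ #[g] = 1.
  by rewrite -lin_charX ?cycle_id // expg_order lin_char1.
by rewrite lin_charX ?cycle_id // Dm rmorphXn /= Dk exprAC.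
Qed.

(** The coefficients of the polynomial whose roots are the conjugates of
    lam * chi g are rational, integral at M, and have powers of p as denominators;
    so they are integers. *)
Lemma Lint_conjugates_Aint (gT : finGroupType) (G : {group gT}) (chi : 'CF(G)) (g : gT)
    (lam : algC) (N : nat) : chi \is a character -> g \in G -> lam \in Crat ->
    (p ^ N)%:R * (lam * chi g) \in Aint ->
    (forall k, coprime k #[g] -> Lint M (lam * chi (g ^+ k)%g)) ->
  lam * chi g \in Aint.
Proof.
move=> Nchi Gg /CratP[l Dl] Ap Lk.
have [Qn galQn [QnC gQnC [_ _ QnG]]] := group_num_field_exists G.
have [a Da] := QnG _ G chi Nchi g (order_dvdG Gg).
pose b : Qn := l *: a.
have Db : QnC b = lam * chi g by rewrite rmorphZ_num Da Dl.
pose P := \prod_(nu in 'Gal({:Qn} / 1)%g) ('X - (nu b)%:P).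
have QP i : P`_i \in 1%VS.
  have /galois_fixedField <- := galQn.
  apply/fixedFieldP; rewrite ?memvf // => nu gal_nu.
  have : map_poly nu P = P.
    rewrite rmorph_prod [RHS](reindex_inj (mulIg nu)) /=.
    apply: eq_big => [tau | tau _]; first by rewrite groupMr.
    by rewrite rmorphB /= map_polyX map_polyC /= galM ?memvf.
  by move=> {2}<-; rewrite coef_map.
pose cs := [seq QnC ((nu : gal_of _) b) | nu <- enum 'Gal({:Qn} / 1)%g].
have DP : map_poly QnC P = \prod_(c <- cs) ('X - c%:P).
  rewrite rmorph_prod big_map big_enum; apply: eq_bigr => nu _.
  by rewrite rmorphB /= map_polyX map_polyC.
have cs_nu c : c \in cs -> exists2 nu : {rmorphism algC -> algC}, True & c = nu (lam * chi g).
  case/mapP=> nuQ _ ->; have [nu Dnu] := gQnC nuQ.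
  by exists nu => //; rewrite -Db -Dnu.
have lam_nu (nu : {rmorphism algC -> algC}) : nu lam = lam by rewrite Dl fmorph_rat.
have Ecs c : c \in cs -> Lint M c /\ exists N, (p ^ N)%:R * c \in Aint.
  case/cs_nu => nu _ ->; split.
    rewrite rmorphM lam_nu; have [k co_k ->] := aut_char_power nu Nchi Gg.
    exact: Lk.
  by exists N; rewrite -[(p ^ N)%:R](rmorph_nat nu) -rmorphM Aint_aut.
apply: (@root_monic_Aint (map_poly QnC P)).
- rewrite -Db fmorph_root /root /P (bigD1 1%g) //= hornerM hornerXsubC.
  by rewrite gal_id subrr mul0r.
- by rewrite DP monic_prod_XsubC.
apply/polyOverP=> i; rewrite coef_map /=.
have [|||| L [N' AN']] := @coef_prod_XsubC_ind
    (fun x => Lint M x /\ exists N, (p ^ N)%:R * x \in Aint) cs _ _ _ _ Ecs i.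
- by split; [apply: (Lint_Aint maxM); apply: rpred0 | exists 0%N; rewrite mulr0 rpred0].
- by split; [apply: (Lint_Aint maxM); apply: rpred1 | exists 0%N; rewrite mulr1 rpred_nat].
- move=> x y [Lx [n1 A1]] [Ly [n2 A2]]; split.
    apply: (LintD maxM) => //; rewrite -mulN1r; apply: (LintM maxM) => //.
    by apply: (Lint_Aint maxM); rewrite rpredN1.
  exists (n1 + n2)%N; rewrite expnD natrM mulrBr; apply: rpredB.
    by rewrite mulrAC; apply: rpredM => //; apply: rpred_nat.
  by rewrite -mulrA; apply: rpredM => //; apply: rpred_nat.
- move=> x y [Lx [n1 A1]] [Ly [n2 A2]]; split; first exact: (LintM maxM).
  exists (n1 + n2)%N; rewrite expnD natrM mulrACA; exact: rpredM.
rewrite -DP coef_map in L AN'.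
have Qc : QnC P`_i \in Crat.
  by have /vlineP[q ->] := QP i; rewrite rmorphZ_num rmorph1 mulr1 Crat_rat.
by apply: Cint_rat_Aint => //; apply: (Lint_rat pr_p maxM) L AN'.
Qed.

End Galois.

(** * Central characters at normal subsets *)

Section Central.
Variables (gT : finGroupType) (G : {group gT}) (i : Iirr G).

(** For a normal subset L, the value of the central character of 'chi_i at the
    sum of L in the group algebra. *)
Definition central_value (L : {set gT}) : algC := (\sum_(l in L) 'chi_i l) / 'chi_i 1%g.

Variable L : {set gT}.
Hypotheses (sLG : L \subset G) (nLG : G \subset 'N(L)).

(** By Schur's lemma the sum of L acts as a scalar in a representation affording
    'chi_i. *)
Lemma central_value_mul x y : x \in G -> y \in G ->
  \sum_(l in L) 'chi_i (x * l * y)%g = central_value L * 'chi_i (x * y)%g.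
Proof.
move=> Gx Gy; pose rG := 'Chi_i; pose X := \sum_(l in L) rG l.
have cX : centgmx rG X.
  apply/centgmxP=> z Gz; rewrite /X mulmx_suml mulmx_sumr [RHS](reindex_inj (conjg_inj z)) /=.
  apply: eq_big => [l | l Ll]; first by rewrite -[in RHS](normP (subsetP nLG z Gz)) memJ_conjg.
  have Gl := subsetP sLG l Ll.
  by rewrite -!repr_mxM ?groupJ // conjgE !mulgA mulgV mul1g.
have /is_scalar_mxP[c Dc] : is_scalar_mx X.
  by apply: mx_abs_irr_cent_scalar cX; apply: groupC; exact: socle_irr.
have chiE z : z \in G -> 'chi_i z = \tr (rG z) by move=> Gz; rewrite -irrRepr cfunE Gz mulr1n.
have key z : z \in G -> \sum_(l in L) 'chi_i (z * l)%g = c * 'chi_i z.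
  move=> Gz; rewrite (eq_bigr (fun l => \tr (rG z *m rG l))) => [|l Ll]; last first.
    by have Gl := subsetP sLG l Ll; rewrite -repr_mxM // chiE ?groupM.
  rewrite -raddf_sum -mulmx_sumr -/X Dc mul_mx_scalar.
  by rewrite -[LHS]/(\tr (c *: rG z)) mxtraceZ -chiE.
have Ec : c = central_value L.
  rewrite /central_value -[LHS](mulfK (irr1_neq0 i)) -key //; congr (_ / _).
  by apply: eq_bigr => l _; rewrite mul1g.
rewrite (eq_bigr (fun l => 'chi_i (y * x * l)%g)) => [|l Ll]; last first.
  by rewrite -[LHS](cfunJ 'chi_i _ (groupVr Gy)) conjgE invgK !mulgA mulgK.
rewrite key ?groupM // Ec; congr (_ * _).
by rewrite -[RHS](cfunJ 'chi_i _ (groupVr Gy)) conjgE invgK !mulgA mulgK.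
Qed.

Lemma central_value_ind (P : algC -> Prop) : P 0 -> (forall x y, P x -> P y -> P (x + y)) ->
  (forall l, l \in L -> P (omega 'chi_i l)) -> P (central_value L).
Proof.
move=> P0 PD PL; rewrite /central_value mulr_suml.
rewrite (partition_big (fun l => l ^: G) (mem [set l ^: G | l in L])) /=; last first.
  by move=> l Ll; apply: imset_f.
apply: big_ind => // _ /imsetP[l Ll ->].
suffices -> : \sum_(j in L | j ^: G == l ^: G) 'chi_i j / 'chi_i 1%g = omega 'chi_i l by apply: PL.
rewrite (eq_bigl (mem (l ^: G))) => [|x /=]; last first.
  apply/andP/idP => [[_ /eqP <-] | /imsetP[y Gy ->]]; first exact: class_refl.
  by rewrite classGidl // eqxx -{1}(normP (subsetP nLG y Gy)) memJ_conjg.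
rewrite (eq_bigr (fun _ => 'chi_i l / 'chi_i 1%g)) => [|_ /imsetP[y Gy ->]]; last by rewrite cfunJ.
by rewrite sumr_const /omega -[LHS]mulr_natl mulrA.
Qed.

Lemma Aint_central_value : central_value L \in Aint.
Proof.
apply: (central_value_ind (P := fun x => x \in Aint)); [exact: rpred0 | exact: rpredD | ].
by move=> l Ll; apply: Aint_class_div_irr1; apply: (subsetP sLG).
Qed.

End Central.

Lemma central_value_class (gT : finGroupType) (G : {group gT}) (i : Iirr G) g : g \in G ->
  central_value i (g ^: G) = omega 'chi_i g.
Proof.
move=> Gg; rewrite /central_value (eq_bigr (fun _ => 'chi_i g)) => [|_ /imsetP[x Gx ->]].
  by rewrite sumr_const -[X in X / _]mulr_natl.
by rewrite cfunJ.
Qed.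

Section TupleSum.
Variable gT : finGroupType.

Definition prodt (b : seq gT) : gT := (\prod_(x <- b) x)%g.

Lemma big_tuple_cons (q : nat) (X : {set gT}) (F : seq gT -> algC) :
  \sum_(t : q.+1.-tuple gT | all (mem X) t) F t
   = \sum_(x in X) \sum_(t : q.-tuple gT | all (mem X) t) F (x :: t).
Proof.
rewrite pair_big /=.
rewrite (reindex (fun u : gT * q.-tuple gT => [tuple of u.1 :: u.2])) //=.
exists (fun t => (thead t, [tuple of behead t])) => [[x t] _ | t _] /=.
  by congr (_, _); apply: val_inj.
by rewrite [t in RHS]tuple_eta; apply: val_inj.
Qed.

(** Each of the q factors in s L of the product contributes one sum over L, which
    amounts to multiplying by the central value of L. *)
Lemma tuple_sum_central (G : {group gT}) (i : Iirr G) (L : {set gT}) s y q :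
    L \subset G -> G \subset 'N(L) -> s \in G -> y \in G ->
  \sum_(t : q.-tuple gT | all (mem (s *: L)%g) t) 'chi_i (y * prodt t)%g
    = central_value i L ^+ q * 'chi_i (y * s ^+ q)%g.
Proof.
move=> sLG nLG Gs; elim: q y => [|q IHq] y Gy.
  rewrite expr0 mul1r (big_pred1 [tuple]) => [|t]; last by rewrite tuple0 /= (introT eqP (tuple0 _)).
  by rewrite /prodt big_nil mulg1.
rewrite (big_tuple_cons q _ (fun t => 'chi_i (y * prodt t)%g)).
rewrite (eq_bigr (fun x => central_value i L ^+ q * 'chi_i (y * x * s ^+ q)%g)) => [|x]; last first.
  case/lcosetP=> l Ll ->; have Gl := subsetP sLG l Ll.
  rewrite -IHq ?groupM //; apply: eq_bigr => t _.
  by rewrite /prodt big_cons !mulgA.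
rewrite -mulr_sumr exprSr -mulrA; congr (_ * _).
rewrite -lcosetE /lcoset big_imset /=; last by move=> ? ? _ _; apply: mulgI.
under eq_bigr do rewrite mulgA.
by rewrite central_value_mul ?groupM ?groupX // expgS mulgA.
Qed.

End TupleSum.

(** * The twisted rotation of tuples *)

Section OrbitSum.
Variables (X : finType) (T : X -> X) (p N k : nat) (f : X -> algC) (B : {pred X}).
Hypotheses (pr_p : prime p) (TN : forall x, iter (p ^ N) T x = x).
Hypotheses (fT : forall x, x \in B -> f (T x) = f x) (BT : forall x, (T x \in B) = (x \in B)).
Hypotheses (Af : forall x, f x \in Aint) (Bk : forall x, x \in B -> iter (p ^ k) T x != x).

(** The map T generates a cyclic p-group, and no orbit in B has a length dividing
    p ^ k. *)
Lemma orbit_sum : exists2 a, a \in Aint & \sum_(x in B) f x = (p ^ k.+1)%:R * a.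
Proof.
have T_inj : injective T.
  move=> x y Txy; rewrite -[x]TN -[y]TN.
  by rewrite -(prednK (n := (p ^ N)%N)) ?expn_gt0 ?prime_gt0 // !iterSr Txy.
pose s := perm T_inj.
have sE n x : ((s ^+ n)%g x) = iter n T x.
  by rewrite permX; apply: eq_iter => y; rewrite permE.
have ps : (#[s]%g %| p ^ N)%N.
  by rewrite order_dvdn; apply/eqP/permP=> x; rewrite sE TN perm1.
have orbE x y : y \in porbit s x -> exists n, y = iter n T x.
  by case/porbitP=> n ->; exists n; rewrite sE.
have Bit n x : (iter n T x \in B) = (x \in B) by elim: n => //= n <-.
have fit n x : x \in B -> f (iter n T x) = f x.
  by move=> Bx; elim: n => //= n <-; rewrite fT ?Bit.
rewrite (partition_big (porbit s) (mem [set porbit s x | x in B])) /=; last first.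
  by move=> x Bx; apply: imset_f.
suffices: forall O, O \in [set porbit s x | x in B] ->
    exists2 a, a \in Aint & \sum_(x in B | porbit s x == O) f x = (p ^ k.+1)%:R * a.
  move=> H; elim/big_ind: _ => [|x y [a Aa ->] [b Ab ->]|O /H//].
    by exists 0; rewrite ?mulr0 ?rpred0.
  by exists (a + b); rewrite ?mulrDr ?rpredD.
move=> _ /imsetP[x Bx ->].
rewrite (eq_bigl (mem (porbit s x))) => [|y /=]; last first.
  rewrite -porbit_sym -eq_porbit_mem eq_sym.
  case: eqP => [E|_]; rewrite ?andbF // andbT.
  have /orbE[n ->] : y \in porbit s x by rewrite -eq_porbit_mem E.
  by rewrite Bit.
rewrite (eq_bigr (fun _ => f x)) => [|y /orbE[n ->]]; last exact: fit.
have [m _ Dm] : exists2 m, (m <= N)%N & #|porbit s x| = (p ^ m)%N.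
  apply/(dvdn_pfactor _ _ pr_p); apply: dvdn_trans ps.
  by rewrite porbitE; apply: (dvdn_orbit _ <[s]>).
have lt_km : (k < m)%N.
  rewrite ltnNge; apply/negP => le_mk; case/negP: (Bk Bx).
  rewrite -(subnK le_mk) expnD iterM iter_fix // -Dm.
  by rewrite -[RHS](iter_porbit s x); apply: eq_iter => y; rewrite permE.
exists ((p ^ (m - k.+1))%:R * f x); first by rewrite rpredM ?rpred_nat.
by rewrite sumr_const -[LHS]mulr_natl Dm mulrA -natrM -expnD subnKC.
Qed.

End OrbitSum.

Section Rotation.
Variables (gT : finGroupType) (u : gT).

Definition twist (x : gT) : gT := (x ^ u^-1)%g.
(** A cyclic rotation, twisted so that the class of u * prodt b does not change
    (rotate_char); a full turn is the conjugation by u^-1. *)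
Definition rotate (b : seq gT) := if b is x :: b' then rcons b' (twist x) else [::].

Lemma size_rotate b : size (rotate b) = size b.
Proof. by case: b => //= x b; rewrite size_rcons. Qed.

Lemma iter_rotate n b : (n <= size b)%N ->
  iter n rotate b = drop n b ++ map twist (take n b).
Proof.
elim: n => [|n IHn] le_n; first by rewrite drop0 take0 cats0.
by rewrite iterS IHn ?(ltnW le_n) // (drop_nth 1%g) // (take_nth 1%g) //= map_rcons rcons_cat.
Qed.

Lemma iter_rotate_size m b : iter (m * size b) rotate b = map (iter m twist) b.
Proof.
elim: m => [|m IHm]; first by rewrite /= map_id.
rewrite mulSn iterD IHm -{1}(size_map (iter m twist) b) iter_rotate //.
by rewrite drop_size take_size -map_comp.
Qed.

Lemma iter_twist m x : iter m twist x = (x ^ u ^- m)%g.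
Proof. by elim: m => [|m IHm]; rewrite ?invg1 ?conjg1 //= IHm /twist -conjgM expgS invMg. Qed.

Lemma all_rotate (A : {set gT}) b : u \in 'N(A) -> all (mem A) (rotate b) = all (mem A) b.
Proof.
move=> nAu; case: b => //= x b; rewrite all_rcons; congr (_ && _).
by rewrite /= /twist -{1}(normP (groupVr nAu)) memJ_conjg.
Qed.

Lemma rotate_char (G : {group gT}) (chi : 'CF(G)) b : u \in G -> {subset b <= G} ->
  chi (u * prodt (rotate b))%g = chi (u * prodt b)%g.
Proof.
move=> Gu; case: b => //= x b Gxb; rewrite /prodt -cats1 big_cat big_seq1 big_cons /=.
have Gx : x \in G by apply: Gxb; rewrite mem_head.
set y := (\prod_(z <- b) z)%g.
have -> : (u * (y * twist x) = (y * u * x) ^ u^-1)%g.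
  by rewrite /twist !conjgE invgK !mulgA.
have -> : (u * (x * y) = (y * u * x) ^ (u * x)^-1)%g.
  by rewrite conjgE invgK -(mulgA y) mulgK mulgA.
by rewrite !cfunJ ?groupV ?groupM.
Qed.

Definition rotate_tuple q (t : q.-tuple gT) : q.-tuple gT :=
  @Tuple q gT (rotate t) (introT eqP (etrans (size_rotate t) (size_tuple t))).

Lemma val_iter_rotate q n (t : q.-tuple gT) :
  val (iter n (@rotate_tuple q) t) = iter n rotate t.
Proof. by elim: n => //= n ->. Qed.

(** An elementary form of Brauer's second main theorem.  The left hand side is the
    sum of 'chi_i (u * prodt b) over the p ^ f-tuples b of elements of s L.  A tuple
    whose orbit under the twisted rotation has a length dividing p ^ f is fixed by a
    full turn, so its elements commute with u.  The other tuples contribute a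
    multiple of p ^ f.+1.  A product of elements of s L that commute with u is in
    N, where 'chi_i can be decomposed. *)
Lemma p_section_congruence (p e f : nat) (G N : {group gT}) (i : Iirr G) (L : {set gT}) s :
    prime p -> (u ^+ (p ^ e) = 1)%g -> (s ^+ (p ^ f) = s)%g -> commute u s ->
    u \in G -> s \in G -> L \subset G -> G \subset 'N(L) ->
    'C_G[u] \subset N -> N \subset G -> N \subset 'N(L :&: 'C[u]) ->
  exists2 a, a \in Aint &
  central_value i L ^+ (p ^ f) * 'chi_i (u * s)%g
    = \sum_j '['Res[N] 'chi_i, 'chi_j] * (central_value j (L :&: 'C[u]) ^+ (p ^ f) * 'chi_j (u * s)%g)
      + (p ^ f.+1)%:R * a.
Proof.
move=> pr_p ue sf cus Gu Gs sLG nLG sCN sNG nLN; set q := (p ^ f)%N.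
set La := L :&: 'C[u] in nLN *.
have sLaC : La \subset 'C_G[u] by rewrite setSI.
have sLaN := subset_trans sLaC sCN.
have Cus : s \in 'C[u] by apply/cent1P.
have Nu : u \in N by rewrite (subsetP sCN) // inE Gu cent1id.
have Ns : s \in N by rewrite (subsetP sCN) // inE Gs.
have lcG : (s *: L)%g \subset G by rewrite -(lcoset_id Gs) mulgS.
pose B := [pred t : q.-tuple gT | all (mem (s *: L)%g) t & ~~ all (mem 'C[u]) t].
have nsLu : u \in 'N((s *: L)%g).
  apply/normP; rewrite conjsMg conjg_set1 (normP (subsetP nLG u Gu)).
  by have /conjg_fixP -> : [~ s, u] == 1%g by apply/commgP.
have nCu : u \in 'N('C[u]) by apply: (subsetP (normG 'C[u])); apply: cent1id.
have [||t|t|t|a Aa Da] := @orbit_sum (q.-tuple gT) (@rotate_tuple q) p (f + e) f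
    (fun t => 'chi_i (u * prodt t)%g) B pr_p.
- move=> t; apply: val_inj; rewrite val_iter_rotate expnD mulnC -/q.
  have := iter_rotate_size (p ^ e) t; rewrite size_tuple => ->; apply: map_id_in => x _.
  by rewrite iter_twist ue invg1 conjg1.
- move=> t /andP[/allP tL _]; apply: rotate_char => // x /tL; exact: (subsetP lcG).
- by rewrite !inE /= !all_rotate.
- exact: Aint_irr.
- rewrite inE /= => /andP[_ /allPn[x tx Cx]]; apply: contra Cx => /eqP/(congr1 val).
  have := iter_rotate_size 1 t; rewrite val_iter_rotate size_tuple mul1n => -> E.
  have : nth 1%g (map (iter 1 twist) t) (index x t) = x by rewrite E nth_index.
  rewrite (nth_map 1%g) ?index_mem // nth_index // iter_twist expg1 => /conjg_fixP/commgP cx.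
  by apply/cent1P; rewrite -[u]invgK; apply: commuteV; apply: commute_sym.
exists a => //; rewrite -{1}sf -tuple_sum_central //.
rewrite (bigID (fun t : q.-tuple gT => all (mem 'C[u]) t)) /= -[X in _ + X]/(\sum_(t in B) _) Da.
congr (_ + _); rewrite (eq_bigl (fun t : q.-tuple gT => all (mem (s *: La)%g) t)) => [|t]; last first.
  rewrite -all_predI; apply: eq_all => x /=; rewrite !mem_lcoset in_setI.
  by rewrite (groupMl _ (groupVr Cus)).
rewrite (eq_bigr (fun t : q.-tuple gT => ('Res[N] 'chi_i) (u * prodt t)%g)) => [|t tL]; last first.
  rewrite cfResE // groupM // /prodt big_seq group_prod // => x tx.
  by have /lcosetP[l Ll ->] := allP tL x tx; rewrite groupM // (subsetP sLaN).
under eq_bigr do rewrite {1}['Res[N] 'chi_i]cfun_sum_cfdot sum_cfunE.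
rewrite exchange_big; apply: eq_bigr => j _ /=.
rewrite -{2}sf -tuple_sum_central // mulr_sumr; apply: eq_bigr => t _.
by rewrite cfunE.
Qed.

End Rotation.

(** * Divisibility at height zero *)

Lemma omega_cent1E (gT : finGroupType) (G : {group gT}) (i : Iirr G) g :
  omega 'chi_i g = #|G|%:R / #|'C_G[g]|%:R * 'chi_i g / (deg i)%:R.
Proof. by rewrite /omega irr1_degree -index_cent1 natf_indexg ?subsetIl. Qed.

(** The sum of Z acts as a scalar in a representation affording 'chi_j.  As 'chi_j
    is constant on g Z, either 'chi_j g = 0 or this scalar is #|Z|, and Z is in the
    kernel of 'chi_j.  In the second case 'chi_j is a character of N / Z, and the
    class of g is the full preimage of its image in N / Z. *)
Lemma normal_shift_dvd (gT : finGroupType) (N Z : {group gT}) g (j : Iirr N) :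
    g \in N -> Z <| N -> (forall z, z \in Z -> (g * z)%g \in g ^: N) ->
  omega 'chi_j g / #|Z|%:R \in Aint.
Proof.
move=> Ng nsZN gZ; have [sZN nZN] := andP nsZN.
have sumZ x : x \in N -> \sum_(z in Z) 'chi_j (x * z)%g = central_value j Z * 'chi_j x.
  move=> Nx; rewrite -[x in RHS]mulg1 -central_value_mul //.
  by apply: eq_bigr => z _; rewrite mulg1.
have [g0 | nz_g] := eqVneq ('chi_j g) 0; first by rewrite /omega g0 mulr0 !mul0r rpred0.
have wZ : central_value j Z = #|Z|%:R.
  apply: (mulIf nz_g); rewrite -sumZ // (eq_bigr (fun _ => 'chi_j g)) => [|z Zz].
    by rewrite sumr_const mulr_natl.
  by have /imsetP[y Ny ->] := gZ z Zz; rewrite cfunJ.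
have kerZ : Z \subset cfker 'chi_j.
  apply/subsetP=> x Zx; have Nx := subsetP sZN x Zx.
  rewrite cfkerEirr inE; apply/eqP; apply: (mulfI (neq0CG Z)).
  rewrite -wZ -!sumZ // (reindex_inj (mulgI x^-1%g)) /=.
  apply: eq_big => [z | z _]; first by rewrite groupMl ?groupV.
  by rewrite mulKVg mul1g.
have irrb : ('chi_j / Z)%CF \in irr (N / Z) by rewrite cfQuo_irr ?mem_irr.
have [l Dl] := irrP irrb.
have Nbg : coset Z g \in (N / Z)%g by apply: mem_quotient.
have := Aint_class_div_irr1 l Nbg; rewrite -Dl cfQuoE // cfQuo1.
congr (_ \in Aint); rewrite /omega -[_ / _ / #|Z|%:R]mulrAC; congr (_ / _).
rewrite mulrAC; congr (_ * _).
suffices -> : #|g ^: N| = (#|Z| * #|coset Z g ^: (N / Z)|)%N.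
  by rewrite natrM mulrAC divff ?neq0CG ?mul1r.
have nZg : g \in 'N(Z) := subsetP nZN g Ng.
have sgN : g ^: N \subset 'N(Z) by apply: subset_trans nZN; rewrite class_subG.
have KZ x z : x \in g ^: N -> z \in Z -> (x * z)%g \in g ^: N.
  case/imsetP=> y Ny -> Zz.
  have Zz' : (z ^ y^-1)%g \in Z by rewrite memJ_norm // groupV (subsetP nZN).
  have /imsetP[y' Ny' E] := gZ _ Zz'.
  have -> : (g ^ y * z = (g * z ^ y^-1) ^ y)%g by rewrite conjMg conjgKV.
  by rewrite E -conjgM imset_f ?groupM.
rewrite -quotient_class // -[X in _ = (_ * X)%N]sum1_card -[LHS]sum1_card.
rewrite (partition_big (coset Z) (mem (g ^: N / Z)%g)) /=; last first.
  by move=> x Kx; apply: mem_morphim => //; apply: (subsetP sgN).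
rewrite big_distrr /=; apply: eq_bigr => _ /morphimP[x0 Nx0 Kx0 ->].
rewrite sum1_card muln1 -(card_lcoset Z x0); apply: eq_card => x.
rewrite mem_lcoset; apply/andP/idP => [[Kx /eqP E] | Zx].
  have Nx : x \in 'N(Z) := subsetP sgN x Kx.
  apply: coset_idr; first by rewrite groupM ?groupV.
  by rewrite morphM ?groupV // morphV //= E mulVg.
have Dx : x = (x0 * (x0^-1 * x))%g by rewrite mulKVg.
split; first by rewrite Dx KZ.
rewrite {1}Dx morphM // ?(subsetP (normG Z) _ Zx) //.
by rewrite [X in (_ * X)%g](coset_id Zx) mulg1.
Qed.

Section HeightZero.
Variables (p : nat) (M : algC -> Prop).
Hypotheses (pr_p : prime p) (maxM : Aint_maximal_over p M).

Lemma exists_prime_power_fix (gT : finGroupType) (s : gT) (m : nat) : p^'.-elt s ->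
  exists2 f, (m <= f)%N & (s ^+ (p ^ f) = s)%g.
Proof.
move=> p's; exists (totient #[s] * m)%N; first by rewrite leq_pmull // totient_gt0.
have co : coprime p #[s].
  by rewrite prime_coprime // -p'natE.
rewrite -[RHS]expg1; apply/eqP; rewrite eq_expg_mod_order expnM.
by rewrite -modnXm Euler_exp_totient // modnXm exp1n.
Qed.

Lemma Lint_div_part n (x : algC) : (0 < n)%N -> Lint M (x / (n`_p)%:R) -> Lint M (x / n%:R).
Proof.
move=> n_gt0 Lx; rewrite -(partnC p n_gt0) natrM invfM mulrA.
apply: (LintM maxM) Lx _; apply: (Lint_invn pr_p maxM).
by rewrite -p'natE // part_pnat.
Qed.

Variables (gT : finGroupType) (G Z : {group gT}) (i : Iirr G) (l0 g : gT) (d : nat).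
Hypotheses (Gl0 : l0 \in G) (Ml0 : ~ M (omega 'chi_i l0)).
Hypotheses (Dd : d = (#|'C_G[l0]|`_p)%N) (Di : ((deg i)`_p * d = #|G|`_p)%N).
Hypotheses (Gg : g \in G) (sZg : Z \subset <[g]>) (pZ : p.-group Z).
Hypothesis gZ : forall z, z \in Z -> (g * z)%g \in g ^: G.

Let u := (g.`_p)%g.
Let s := (g.`_p^')%g.
Let N := 'N_G(<[u]>)%G.
Let c := (#|Z| * #|'C_G[g]|)%N.
Let La := (l0 ^: G) :&: 'C[u].

Lemma cent1_sub_normalizer : 'C_G[g] \subset N.
Proof.
apply: subset_trans (_ : 'C_G[u] \subset _).
  by apply: setIS; rewrite -!cent_cycle centS // cycle_subG mem_cycle.
by apply: setIS; rewrite -cent_cycle cent_sub.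
Qed.

Lemma shift_sub_constt : Z \subset <[u]>.
Proof.
apply/subsetP=> z Zz; have /cycleP[k Dz] := subsetP sZg z Zz.
have -> : z = z.`_p%g by rewrite constt_p_elt // (mem_p_elt pZ).
by rewrite Dz consttX mem_cycle.
Qed.

Lemma shift_normal : Z <| N.
Proof.
apply: char_normal_trans (cycle_subgroup_char shift_sub_constt) (normalSG _).
by rewrite cycle_subG groupX.
Qed.

Lemma shift_class_normalizer z : z \in Z -> (g * z)%g \in g ^: N.
Proof.
move=> Zz; have /imsetP[y Gy Dy] := gZ Zz; rewrite Dy imset_f // inE Gy /=.
have Duy : (u ^ y = u * z)%g.
  rewrite /u -consttJ -Dy consttM; last first.
    by have /cycleP[k ->] := subsetP sZg z Zz; apply: commuteX.
  by rewrite [z.`_p%g]constt_p_elt // (mem_p_elt pZ).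
apply/normP/eqP; rewrite eqEcard cardJg leqnn andbT -cycleJ cycle_subG Duy.
by rewrite groupM ?cycle_id // (subsetP shift_sub_constt).
Qed.

(** Some l in La has its central character value outside M.  As that value is a
    unit at M, #|N| / 'chi_j 1 divides #|'C_N[l]|, and hence d, locally at M.  On the
    other hand #|Z| divides omega 'chi_j g. *)
Lemma normalizer_term_Lint (j : Iirr N) : ~ M (central_value j La) -> Lint M (d%:R * 'chi_j g / c%:R).
Proof.
move=> Mj; have nLaN : N \subset 'N(La).
  rewrite normsI //; first by rewrite (subset_trans (subsetIl _ _)) // class_norm.
  by rewrite -cent_cycle (subset_trans (subsetIr _ _)) // cent_norm.
have sLaN : La \subset N.
  rewrite /La setISS //; first by rewrite class_subG.
  by rewrite -cent_cycle cent_sub.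
have [l Ll Ml] : exists2 l, l \in La & ~ M (omega 'chi_j l).
  apply: NNPP => noL; apply: Mj; have idM := Aint_maximal_ideal maxM.
  apply: central_value_ind => //; [exact: Aint_ideal0 idM | exact: Aint_idealD idM |].
  by move=> l Ll; apply: NNPP => Ml; apply: noL; exists l.
have Nl := subsetP sLaN l Ll.
have Ng : g \in N by rewrite (subsetP cent1_sub_normalizer) // inE Gg cent1id.
pose a := omega 'chi_j g / #|Z|%:R.
have Aa : a \in Aint := normal_shift_dvd j Ng shift_normal shift_class_normalizer.
have Aw : omega 'chi_j l \in Aint by apply: Aint_class_div_irr1.
have nzw : omega 'chi_j l != 0.
  by apply: contra_notN Ml => /eqP->; apply: Aint_ideal0 (Aint_maximal_ideal maxM).
have DC : 'C_N[g] = 'C_G[g].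
  apply/eqP; rewrite eqEsubset setSI ?subsetIl //= subsetI cent1_sub_normalizer.
  by rewrite subsetIr.
have -> : d%:R * 'chi_j g / c%:R
    = a * 'chi_j l * (omega 'chi_j l)^-1 * (d%:R / #|'C_N[l]|%:R).
  have nzl : 'chi_j l != 0.
    by apply: contraNneq nzw => l0'; rewrite /omega l0' mulr0 mul0r.
  rewrite /a !omega_cent1E DC /c natrM; field.
  by rewrite nzl !neq0CG pnatr_eq0 -lt0n irr_degree_gt0.
apply: (LintM maxM); last first.
  apply: Lint_div_part; first exact: cardG_gt0.
  apply: (Lint_Aint maxM).
  have /dvdnP[k ->] : (#|'C_N[l]|`_p %| d)%N.
    have /setIP[/imsetP[y Gy Dl] _] := Ll.
    rewrite Dd -(cardJg 'C_G[l0] y) conjIg conjGid // -cent1J -Dl.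
    by rewrite partn_dvd ?cardG_gt0 // cardSg // setSI ?subsetIl.
  by rewrite natrM mulfK ?rpred_nat // pnatr_eq0 -lt0n part_gt0.
apply: (LintM maxM); last exact: (Lint_inv maxM).
by apply: (Lint_Aint maxM); rewrite rpredM ?Aint_irr.
Qed.

(** In p_section_congruence, for a large exponent f, the terms of the characters of
    N whose central value at La is in M are divisible by a high power of p, as is the
    last term.  The remaining terms are controlled by normalizer_term_Lint, and
    omega 'chi_i l0 is a unit at M. *)
Lemma height0_shift_Lint : Lint M (omega 'chi_i g / #|Z|%:R).
Proof.
have idM := Aint_maximal_ideal maxM.
pose K := logn p c.
have c_gt0 : (0 < c)%N by rewrite muln_gt0 !cardG_gt0.
have cp : (c`_p = p ^ K)%N by rewrite p_part.
have nzpK : (p ^ K)%:R != 0 :> algC by rewrite pnatr_eq0 -lt0n expn_gt0 prime_gt0.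
have /fin_all_exists[q0 Dq0] (j : Iirr N) : exists q0, M (central_value j La) ->
    forall q, (q0 <= q)%N -> Lint M (central_value j La ^+ q / (p ^ K)%:R).
  have [Mj | notMj] := classic (M (central_value j La)); last by exists 0%N.
  by have [q0 Dq0] := maxideal_exp_Lint pr_p maxM K Mj; exists q0.
have p's : p^'.-elt s by apply: p_elt_constt.
have [f le_f sf] := exists_prime_power_fix (K + \sum_j q0 j) p's.
have pu : p.-elt u by apply: p_elt_constt.
have [e De] : {e | #[u] = (p ^ e)%N} := p_natP pu.
have cus : commute u s by apply: commuteX2.
have nLG : G \subset 'N(l0 ^: G) by apply: class_norm.
have sLG : l0 ^: G \subset G by rewrite class_subG.
have [Gu Gs] : u \in G /\ s \in G by rewrite !groupX.
have sCN : 'C_G[u] \subset N by apply: setIS; rewrite -cent_cycle cent_sub.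
have sNG : N \subset G by apply: subsetIl.
have nLaN : N \subset 'N(La).
  rewrite normsI //; first by rewrite (subset_trans sNG).
  by rewrite -cent_cycle (subset_trans (subsetIr _ _)) // cent_norm.
have ue : (u ^+ (p ^ e) = 1)%g by rewrite -De expg_order.
have [a Aa] := p_section_congruence i pr_p ue sf cus Gu Gs sLG nLG sCN sNG nLaN.
have -> : (u * s)%g = g by apply: consttC.
rewrite central_value_class //; set q := (p ^ f)%N => E.
have le_q j : (q0 j <= q)%N.
  apply: leq_trans (ltnW (ltn_expl f (prime_gt1 pr_p))); apply: leq_trans le_f.
  by rewrite (bigD1 j) //= addnCA leq_addr.
have Lterm : Lint M (d%:R * 'chi_i g / c%:R).
  have Aw : omega 'chi_i l0 \in Aint by apply: Aint_class_div_irr1.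
  have nzw : omega 'chi_i l0 ^+ q != 0.
    apply: contra_notN Ml0; rewrite expf_eq0 => /andP[_ /eqP->].
    exact: Aint_ideal0 idM.
  have -> : d%:R * 'chi_i g / c%:R
      = (omega 'chi_i l0 ^+ q)^-1 * (d%:R * (omega 'chi_i l0 ^+ q * 'chi_i g) / c%:R).
    have nzc : c%:R != 0 :> algC by rewrite pnatr_eq0 -lt0n.
    by field; rewrite nzw nzc.
  apply: (LintM maxM).
    by apply: (Lint_inv maxM); [rewrite rpredX | apply: (maxideal_exp maxM)].
  rewrite E mulrDr mulrDl; apply: (LintD maxM); last first.
    apply: Lint_div_part => //; rewrite cp; apply: (Lint_Aint maxM).
    have -> : (p ^ f.+1 = p ^ (f.+1 - K) * p ^ K)%N.
      rewrite -expnD subnK //; apply: leq_trans (leqW le_f); exact: leq_addr.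
    rewrite natrM (_ : _ / _ = d%:R * (p ^ (f.+1 - K))%:R * a); last by field.
    by rewrite !rpredM ?rpred_nat.
  rewrite mulr_sumr mulr_suml; apply: (Lint_sum maxM) => j _.
  have An : '['Res[N] 'chi_i, 'chi_j] \in Aint.
    by rewrite Aint_Cnat // Cnat_cfdot_char ?cfRes_char ?irr_char.
  have Aj : central_value j La \in Aint.
    apply: Aint_central_value => //; rewrite setISS //.
    by rewrite -cent_cycle cent_sub.
  have [Mj | notMj] := classic (M (central_value j La)).
    apply: Lint_div_part => //; rewrite cp.
    rewrite (_ : _ / _ = d%:R * '['Res[N] 'chi_i, 'chi_j] * 'chi_j g
       * (central_value j La ^+ q / (p ^ K)%:R)); last by ring.
    apply: (LintM maxM); last exact: Dq0.
    apply: (Lint_Aint maxM); apply: rpredM; last exact: Aint_irr.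
    by apply: rpredM => //; apply: rpred_nat.
  rewrite (_ : _ / _ = '['Res[N] 'chi_i, 'chi_j] * central_value j La ^+ q
       * (d%:R * 'chi_j g / c%:R)); last by ring.
  apply: (LintM maxM); last exact: normalizer_term_Lint.
  by apply: (Lint_Aint maxM); apply: rpredM => //; apply: rpredX.
have di_gt0 := irr_degree_gt0 (socle_of_Iirr i).
have nzs n (pi : nat_pred) : (n`_pi)%:R != 0 :> algC by rewrite pnatr_eq0 -lt0n part_gt0.
have -> : omega 'chi_i g / #|Z|%:R
    = (#|G|`_p^')%:R / ((deg i)`_p^')%:R * (d%:R * 'chi_i g / c%:R).
  rewrite omega_cent1E.
  have -> : #|G|%:R = ((deg i)`_p)%:R * d%:R * (#|G|`_p^')%:R :> algC.
    by rewrite -!natrM Di partnC.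
  have {1}-> : (deg i)%:R = ((deg i)`_p)%:R * ((deg i)`_p^')%:R :> algC by rewrite -natrM partnC.
  by rewrite /c natrM; field; rewrite !nzs !neq0CG.
apply: (LintM maxM) Lterm; apply: (LintM maxM); first by apply: (Lint_Aint maxM); apply: rpred_nat.
by apply: (Lint_invn pr_p maxM); rewrite -p'natE // part_pnat.
Qed.

End HeightZero.

(** The element l0 and the ideal M have no relation to g, so that the
    divisibility at M holds for all g ^+ k with k prime to the order of g, and thus
    for all the conjugates of omega 'chi_i g. *)
Theorem height0_shift_dvd (p : nat) (M : algC -> Prop) (gT : finGroupType)
    (G Z : {group gT}) (i : Iirr G) (l0 g : gT) :
    prime p -> Aint_maximal_over p M -> l0 \in G -> ~ M (omega 'chi_i l0) ->
    ((deg i)`_p * #|'C_G[l0]|`_p = #|G|`_p)%N ->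
    g \in G -> Z \subset <[g]> -> p.-group Z ->
    (forall z, z \in Z -> (g * z)%g \in g ^: G) ->
  omega 'chi_i g / #|Z|%:R \in Aint.
Proof.
move=> pr_p maxM Gl0 Ml0 Di Gg sZg pZ gZ.
pose lam : algC := #|g ^: G|%:R / 'chi_i 1%g / #|Z|%:R.
have Elam h : #|h ^: G| = #|g ^: G| -> omega 'chi_i h / #|Z|%:R = lam * 'chi_i h.
  by move=> E; rewrite /omega E /lam; ring.
have [N DN] : {N | #|Z| = (p ^ N)%N} := p_natP pZ.
rewrite Elam //; apply: (Lint_conjugates_Aint pr_p maxM (N := N)) => //; first exact: irr_char.
- by rewrite /lam irr1_degree !rpred_div ?rpred_nat.
- rewrite -Elam // -DN mulrC divfK ?neq0CG //; exact: Aint_class_div_irr1.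
move=> k co_k; have Dgk : <[g ^+ k]> = <[g]>.
  by apply/eqP; rewrite eq_sym -[_ == _]/(generator <[g]> (g ^+ k)) generator_coprime coprime_sym.
have CE : 'C_G[g ^+ k] = 'C_G[g] by rewrite -!cent_cycle Dgk.
rewrite -Elam; last by rewrite -!index_cent1 CE.
apply: (height0_shift_Lint pr_p maxM Gl0 Ml0 (erefl _) Di) => //; first exact: groupX.
  by rewrite Dgk.
move=> z Zz; have co_kZ : coprime #|Z| k.
  by rewrite coprime_sym; apply: coprime_dvdr co_k; rewrite cardSg.
have Zk : (z ^+ (expg_invn Z k))%g \in Z by rewrite groupX.
have Dz : z = ((z ^+ (expg_invn Z k)) ^+ k)%g by rewrite -expgM mulnC expgM expgK.
have /imsetP[y Gy Dy] := gZ _ Zk.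
have cgz : commute g (z ^+ (expg_invn Z k)).
  by have /cycleP[m ->] := subsetP sZg _ Zk; apply: commuteX.
by rewrite Dz -expgMn // Dy -conjXg imset_f.
Qed.

(** * The divisibility theorem *)

Theorem corollary5p8 (gT : finGroupType) (G : {group gT}) (chi : 'CF(G))
    (irr_chi : chi \in irr G) :
  (solvable G ->
     forall g : gT, g \in G ->
       (#|Autg0 G g|%:R %| omega chi g)%A)
  /\
  (forall p : nat, prime p -> height_zero p chi ->
     forall g : gT, g \in G ->
       ((#|Autg0 G g|`_p)%:R %| omega chi g)%A).
Proof.
have /irrP[i ->] := irr_chi.
have Aomega g : g \in G -> omega 'chi_i g \in Aint by apply: Aint_class_div_irr1.
have dvdAE n (x : algC) : (0 < n)%N -> x / n%:R \in Aint -> (n%:R %| x)%A.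
  by move=> n_gt0 Ax; rewrite unfold_in; case: ifP => // /idPn[]; rewrite pnatr_eq0 -lt0n.
split=> [solG g Gg | p pr_p [M [B [D [maxM blockB [i0 Bi0 Di0] defD htD]]]] g Gg].
  apply: dvdAE; first exact: card_Autg0_gt0.
  apply: dvd_card_Autg0; last exact: Aomega.
  move=> p p_n; have [Z [sZg pZ <- gZ]] := Autg0_at_shift G p_n.
  apply: (solvable_shift_dvd Gg sZg pZ gZ i _ solG).
  by move: p_n; rewrite mem_primes => /andP[].
have {Di0} ii0 : i0 = i by apply: irr_inj.
rewrite {i0}ii0 in Bi0.
have [l0 [Gl0 Ml0 _ sylD]] := defD.
apply: dvdAE; first exact: part_gt0.
have [p_n | p'n] := boolP (p \in primes #[g]); last by rewrite part_Autg0_out ?divr1 ?Aomega.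
rewrite part_Autg0 //; have [Z [sZg pZ <- gZ]] := Autg0_at_shift G p_n.
apply: (height0_shift_dvd pr_p maxM Gl0 (Ml0 i Bi0)) => //.
rewrite -(card_Hall sylD); move: htD; rewrite irr1_degree natrK => ->.
rewrite divnK // (card_Hall sylD) partn_dvd ?cardG_gt0 // cardSg ?subsetIl //.
Qed.
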